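(* Assume $\mathbb{P}$ is generated by a PLSEM and is faithful to the DAG of that PLSEM. Then: (a) Let $D\in\mathscr{D}(\mathbb{P})$, let $i\to j$ be a covered edge in $D$, and let $D'$ be the DAG obtained from $D$ by reversing only $i\to j$. Then $D'\in\mathscr{D}(\mathbb{P})$ if and only if $i\to j$ is linear in $D$. Moreover, if $i\to j$ is covered and nonlinear in $D$, then $i\to j$ (with this orientation) in every DAG in $\mathscr{D}(\mathbb{P})$. (b) For any $D,D'\in\mathscr{D}(\mathbb{P})$ there is a sequence $D=D_1,D_2,\dots,D_m=D'$ where each $D_{r+1}$ is obtained from $D_r$ by reversing one edge that is covered and linear in $D_r$, and no edge (pair of nodes) is reversed more than once.
   Context: A PLSEM with DAG $D$ on $\{1,\dots,p\}$ is a system $X_j=\mu_j+\sum_{i\in\mathrm{pa}_D(j)} f_{j,i}(X_i)+\varepsilon_j$, $j=1,\dots,p$, where $\mu_j\in\mathbb{R}$, $f_{j,i}\in C^2(\mathbb{R})$, $f_{j,i}\not\equiv 0$, $\mathbb{E}[f_{j,i}(X_i)]=0$, and $\varepsilon_1,\dots,\varepsilon_p$ are mutually independent with $\varepsilon_j\sim\mathcal{N}(0,\sigma_j^2)$, $\sigma_j^2>0$; the distribution of the solution $X$ is said to be generated by the PLSEM. $\mathbb{P}$ is faithful to $D$ if the conditional independences in $\mathbb{P}$ are exactly those implied by d-separation in $D$. $\mathscr{D}(\mathbb{P})=\{D:\ \mathbb{P}\text{ faithful to }D\text{ and some PLSEM with DAG }D\text{ generates }\mathbb{P}\}$. For $D\in\mathscr{D}(\mathbb{P})$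 the PLSEM with DAG $D$ generating $\mathbb{P}$ is unique; an edge $i\to j$ of $D$ is called linear in $D$ if $f_{j,i}''\equiv 0$ in this PLSEM, and nonlinear otherwise. An edge $i\to j$ is covered in $D$ if $\mathrm{pa}_D(i)=\mathrm{pa}_D(j)\setminus\{i\}$. *)

(* Defs.v *)
From HB Require Import structures.
From mathcomp Require Import all_boot all_order all_algebra.
From mathcomp Require Import all_classical all_reals all_analysis.
Set Implicit Arguments. Unset Strict Implicit. Unset Printing Implicit Defensive.
Import Order.TTheory GRing.Theory Num.Theory.
Import numFieldNormedType.Exports.
Local Open Scope classical_set_scope.
Local Open Scope ring_scope.

Definition dag (p : nat) := {set 'I_p * 'I_p}.

Definition edge_rel p (D : dag p) : rel 'I_p := fun x y => (x, y) \in D.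

Definition is_dag p (D : dag p) : Prop :=
  forall i j, (i, j) \in D -> ~~ connect (edge_rel D) j i.

Definition parents p (D : dag p) (j : 'I_p) : {set 'I_p} := [set i | (i, j) \in D].

Definition reverse_edge p (D : dag p) (i j : 'I_p) : dag p :=
  (D :\ (i, j)) :|: [set (j, i)].

Definition covered p (D : dag p) (i j : 'I_p) : Prop :=
  (i, j) \in D /\ parents D i = parents D j :\ i.

Definition active_path p (D : dag p) (C : {set 'I_p}) (s : seq 'I_p) : Prop :=
  match s with
  | [::] => False
  | a :: r =>
    [/\ uniq s,
        path (fun x y => ((x, y) \in D) || ((y, x) \in D)) a r &
        forall k, (0 < k)%N -> (k.+1 < size s)%N ->
          let u := nth a s k.-1 in let v := nth a s k in let w := nth a s k.+1 in
          if ((u, v) \in D) && ((w, v) \in D)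
          then exists2 c, c \in C & connect (edge_rel D) v c
          else v \notin C]
  end.

Definition d_separated p (D : dag p) (A B C : {set 'I_p}) : Prop :=
  ~ exists s : seq 'I_p, exists a b,
      [/\ a \in A, b \in B, head a s = a, last a s = b & active_path D C s].

Section Prob.
Context (R : realType) (d : measure_display) (Omega : measurableType d)
        (P : probability Omega R) (p : nat) (X : 'I_p -> Omega -> R).

Definition sigmaX (S : {set 'I_p}) : set (set Omega) :=
  <<s [set E | exists s B, [/\ s \in S, measurable B & E = X s @^-1` B]] >>.

Definition is_condprob (F : set (set Omega)) (E : set Omega) (h : Omega -> R) : Prop :=
  [/\ forall U : set R, measurable U -> F (h @^-1` U),
      P.-integrable setT (fun w => (h w)%:E) &
      forall G, F G -> P (E `&` G) = (\int[P]_(w in G) (h w)%:E)%E].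

Definition cond_indep (A B C : {set 'I_p}) : Prop :=
  forall EA EB, sigmaX A EA -> sigmaX B EB ->
  forall ha hb hab, is_condprob (sigmaX C) EA ha -> is_condprob (sigmaX C) EB hb ->
    is_condprob (sigmaX C) (EA `&` EB) hab ->
    {ae P, forall w, hab w = ha w * hb w}.

Definition faithful (D : dag p) : Prop :=
  forall A B C : {set 'I_p}, disjoint (mem A) (mem B) -> disjoint (mem A) (mem C) ->
    disjoint (mem B) (mem C) ->
    (cond_indep A B C <-> d_separated D A B C).

Definition mutually_independent (Y : 'I_p -> Omega -> R) : Prop :=
  forall B : 'I_p -> set R, (forall j, measurable (B j)) ->
    P (\bigcap_(j in [set: 'I_p]) (Y j @^-1` B j)) =
    (\prod_(j < p) P (Y j @^-1` B j))%E.

Definition C2 (f : R -> R) : Prop :=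
  [/\ forall x, derivable f x 1, forall x, derivable (derive1 f) x 1 &
      continuous (derive1n 2 f)].

(** the distribution of X is generated by the PLSEM (D, mu, f, sigma):
    the residuals eps_j := X_j - mu_j - sum_{i in pa(j)} f_{j,i}(X_i) are
    mutually independent N(0, sigma_j^2), sigma_j > 0 (standard deviation). *)
Definition PLSEM_generates (D : dag p) (mu : 'I_p -> R)
    (f : 'I_p -> 'I_p -> R -> R) (sigma : 'I_p -> R) : Prop :=
  [/\ forall j, 0 < sigma j,
      forall i j, (i, j) \in D ->
        [/\ C2 (f j i), exists x, f j i x != 0,
            P.-integrable setT (fun w => (f j i (X i w))%:E) &
            (\int[P]_w (f j i (X i w))%:E = 0)%E] &
      let eps j w := X j w - mu j - \sum_(i in parents D j) f j i (X i w) in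
      mutually_independent eps /\
      forall j (B : set R), measurable B ->
        P (eps j @^-1` B) = normal_prob 0 (sigma j) B].

Definition generated_by (D : dag p) : Prop :=
  exists mu f sigma, PLSEM_generates D mu f sigma.

Definition inDP (D : dag p) : Prop := [/\ is_dag D, faithful D & generated_by D].

(** i -> j is linear in D \in \mathscr{D}(P) (for the (unique) generating PLSEM) *)
Definition linear_in (D : dag p) (i j : 'I_p) : Prop :=
  inDP D /\ forall mu f sigma, PLSEM_generates D mu f sigma ->
    forall x, derive1n 2 (f j i) x = 0.

Fixpoint reversal_chain (D : dag p) (es : seq ('I_p * 'I_p)) (D' : dag p) : Prop :=
  match es with
  | [::] => D = D'
  | e :: es' => [/\ covered D e.1 e.2, linear_in D e.1 e.2 &
                   reversal_chain (reverse_edge D e.1 e.2) es' D']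
  end.

End Prob.

Definition upair p (e : 'I_p * 'I_p) : {set 'I_p} := [set e.1; e.2]%SET.

(* Main.v *)
(** The Bayes-ball description of d-separation shows that reversing a covered
    edge preserves all d-separations, so that faithful DAGs of one distribution
    can be compared along Chickering's sequence of covered reversals.

    If the covered edge [i -> j] is linear, rotating the pair of independent
    noises [(eps_i, eps_j)] gives two independent normal noises for the reversed
    DAG, and faithfulness forces the new edge functions to be nonzero.

    Conversely, the probability that [X] lies in a small box divided by the
    volume of the box converges to the product of the noise densities at the
    residuals, whatever the DAG.  Hence any two models have the same weighted sum
    of squared residuals [Q] up to a constant.  If [t] is a sink of [D'], then
    [Q] is quadratic in [x_t] with constant leading coefficient, which forces
    all edges of [D] leaving [t] to be affine; completing squares moves [t] to
    the end of a topological order of [D], minimising over [x_t] deletes it from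
    both models, and one recurses until [t = i].  The function of a covered
    edge [i -> j] is only changed by affine terms along the way. *)

Require Import Defs.
From HB Require Import structures.
From mathcomp Require Import all_boot all_order all_algebra.
From mathcomp Require Import all_classical all_reals all_analysis.
From mathcomp Require Import measurable_realfun.
From mathcomp Require Import ring lra zify.
Set Implicit Arguments. Unset Strict Implicit. Unset Printing Implicit Defensive.
Import Order.TTheory GRing.Theory Num.Theory.

(** The given d-separation uses simple paths and opens a collider by a possibly distant descendant,
    which is hard to follow through an edge reversal. Walks with purely local conditions replace it;
    the price is the removal of loops that shows both notions equal.

    Chickering's choice of an edge needs faithful DAGs to share skeleton and immoralities, and both
    are read off from explicit separating sets.

    No [p]-dimensional density is ever formed: a box is treated one coordinate at a time,
    conditioning on the earlier ones. Continuity of the edge functions gives the limit at every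
    point, so the two quadratic forms agree everywhere and can be compared as functions.

    The reversed model must be a PLSEM in the strict sense. Centering the new edge function requires
    the mean of [X j], hence a first-moment bound for normal laws. A vanishing edge function would
    make two adjacent vertices conditionally independent given the other parents, which d-separation
    never allows for adjacent vertices. *)

Section Dag.
Variable p : nat.
Implicit Types (D : dag p) (C : {set 'I_p}) (i j u v w : 'I_p) (s : seq 'I_p).

(** * Acyclicity and ancestor ranks *)

Lemma edge_connect D u v : (u, v) \in D -> connect (edge_rel D) u v.
Proof. exact: connect1. Qed.

Lemma dag_noloop D u : is_dag D -> (u, u) \notin D.
Proof. by move=> dD; apply/negP => /dD; rewrite connect0. Qed.

Lemma dag_asym D u v : is_dag D -> (u, v) \in D -> (v, u) \notin D.
Proof. by move=> dD /dD; apply: contra => /edge_connect. Qed.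

Lemma dag_neq D u v : is_dag D -> (u, v) \in D -> u != v.
Proof. by move=> dD; apply: contraTneq => ->; exact: dag_noloop. Qed.

(** Counting ancestors gives a numbering that strictly grows along edges, so graph arguments become
    inductions and extremal choices on natural numbers. *)
Definition rank D v : nat := #|[set x | connect (edge_rel D) x v]|.

Lemma rank_lt D u v : is_dag D -> (u, v) \in D -> rank D u < rank D v.
Proof.
move=> dD uv; apply: proper_card; apply/properP; split.
  by apply/fintype.subsetP => x; rewrite !inE => /connect_trans; apply; exact: edge_connect.
by exists v; rewrite !inE ?connect0// dD.
Qed.

Lemma rank_connect D u v : is_dag D -> connect (edge_rel D) u v -> u != v -> rank D u < rank D v.
Proof.
move=> dD /connectP[s ps ->]; elim: s u ps => [|x s IH] u /=; first by rewrite eqxx.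
case/andP=> ux ps _; have := rank_lt dD ux.
have [<- //|xl] := eqVneq x (last x s).
by move=> /ltn_trans; apply; exact: IH.
Qed.

Lemma dag_of_rank D (h : 'I_p -> nat) :
  (forall u v, (u, v) \in D -> h u < h v) -> is_dag D.
Proof.
move=> hlt u v uv; apply/negP => /connectP[s].
have : h u < h v by exact: hlt.
elim: s v {uv} => /= [|x s IH] v huv; first by move=> _ E; rewrite E ltnn in huv.
by case/andP => vx; apply: IH; rewrite (ltn_trans huv)// hlt.
Qed.

(** * d-separation and reachability *)

Definition adjacent D u v := ((u, v) \in D) || ((v, u) \in D).

Lemma adjacentC D u v : adjacent D u v = adjacent D v u.
Proof. by rewrite /adjacent orbC. Qed.

(* The flag is [true] when the last edge of the walk points into its endpoint. A collider is passed only when it lies in [C]; a collider with a descendant in [C] is passed by walking down to [C] and back, so vertices may repeat. *)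
Inductive reach D C (a : 'I_p) : 'I_p -> bool -> Prop :=
| reach_start : reach D C a a false
| reach_down v b w : reach D C a v b -> v \notin C -> (v, w) \in D -> reach D C a w true
| reach_up v w : reach D C a v false -> v \notin C -> (w, v) \in D -> reach D C a w false
| reach_collider v w : reach D C a v true -> v \in C -> (w, v) \in D -> reach D C a w false.

Definition ancestor_of D C v := exists2 c, c \in C & connect (edge_rel D) v c.

Lemma ancestor_connect D C u v : connect (edge_rel D) u v -> ancestor_of D C v -> ancestor_of D C u.
Proof. by move=> uv [c cC vc]; exists c => //; exact: connect_trans vc. Qed.

(** The loop-free counterpart of [reach]: the list holds the visited vertices, latest first, and a
    collider is passed directly as soon as it has a descendant in [C], as in [active_path]. *)
Inductive spath D C (a : 'I_p) : seq 'I_p -> 'I_p -> bool -> Prop :=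
| spath_start : spath D C a [:: a] a false
| spath_down s v b w : spath D C a s v b -> v \notin C -> (v, w) \in D -> w \notin s ->
    spath D C a (w :: s) w true
| spath_up s v w : spath D C a s v false -> v \notin C -> (w, v) \in D -> w \notin s ->
    spath D C a (w :: s) w false
| spath_collider s v w : spath D C a s v true -> ancestor_of D C v -> (w, v) \in D -> w \notin s ->
    spath D C a (w :: s) w false.

(** Truncation at an inner vertex [w]. If the shortened path enters [w] by an arrow, the discarded
    part descends from [w] until it either arrives at [v] still descending or meets a collider,
    whose descendant in [C] is then one of [w]. If it enters against an arrow, [w] was passed as a
    non-collider and lies outside [C]. *)
Lemma spath_cut D C a s v b : a \notin C -> spath D C a s v b -> forall w, w \in s -> w != v ->
  exists s' b', [/\ spath D C a s' w b', b' = false -> w \notin C &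
    b' = true -> ancestor_of D C w \/ (b = true /\ connect (edge_rel D) w v)].
Proof.
move=> aC; elim=> {s v b} [|s v b u sp IH vC vu us|s v u sp IH vC uv us|s v u sp IH av uv us] w.
- by rewrite inE => /eqP->; rewrite eqxx.
- rewrite inE => /orP[/eqP->|ws _]; first by rewrite eqxx.
  have [->|wv] := eqVneq w v.
    by exists s, b; split => // _; right; split => //; exact: edge_connect.
  have [s' [b' [sp' hf ht]]] := IH w ws wv; exists s', b'; split => // /ht[]; first by left.
  by case=> _ wv'; right; split => //; exact: connect_trans (edge_connect vu).
- rewrite inE => /orP[/eqP->|ws _]; first by rewrite eqxx.
  have [->|wv] := eqVneq w v; first by exists s, false.
  have [s' [b' [sp' hf ht]]] := IH w ws wv; exists s', b'; split => // /ht[]; first by left.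
  by case.
- rewrite inE => /orP[/eqP->|ws _]; first by rewrite eqxx.
  have [->|wv] := eqVneq w v; first by exists s, true; split => // _; left.
  have [s' [b' [sp' hf ht]]] := IH w ws wv; exists s', b'; split => // /ht[]; first by left.
  by case=> _ wv'; left; exact: ancestor_connect av.
Qed.

(** Removing a loop can turn the last arrow around, so the induction carries an alternative with the
    opposite flag. The side condition on [v] guarantees that every continuation open to the walk is
    also open to the path. *)
Lemma reach_spath D C a v b : is_dag D -> a \notin C -> reach D C a v b ->
  if b then (exists s, spath D C a s v true) \/ (v \notin C /\ exists s, spath D C a s v false)
  else (exists s, spath D C a s v false) \/ (ancestor_of D C v /\ exists s, spath D C a s v true).
Proof.
move=> dD aC.
have down s u b' w : spath D C a s u b' -> u \notin C -> (u, w) \in D ->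
    (exists s, spath D C a s w true) \/ (w \notin C /\ exists s, spath D C a s w false).
  move=> sp uC uw; have [ws|ws] := boolP (w \in s); last first.
    by left; exists (w :: s); exact: spath_down sp _ _ _.
  have [|s' [[] [sp' hf _]]] := spath_cut aC sp ws; first by rewrite eq_sym (dag_neq dD uw).
    by left; exists s'.
  by right; split; [exact: hf|exists s'].
have up s u w : spath D C a s u false -> u \notin C -> (w, u) \in D ->
    (exists s, spath D C a s w false) \/ (ancestor_of D C w /\ exists s, spath D C a s w true).
  move=> sp uC uw; have [ws|ws] := boolP (w \in s); last first.
    by left; exists (w :: s); exact: spath_up sp _ _ _.
  have [|s' [[] [sp' _ ht]]] := spath_cut aC sp ws; first by rewrite (dag_neq dD uw).
    by right; split; [case: (ht erefl) => // -[]|exists s'].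
  by left; exists s'.
have coll s u w : spath D C a s u true -> ancestor_of D C u -> (w, u) \in D ->
    (exists s, spath D C a s w false) \/ (ancestor_of D C w /\ exists s, spath D C a s w true).
  move=> sp uC uw; have [ws|ws] := boolP (w \in s); last first.
    by left; exists (w :: s); exact: spath_collider sp _ _ _.
  have [|s' [[] [sp' _ ht]]] := spath_cut aC sp ws; first by rewrite (dag_neq dD uw).
    right; split; last by exists s'.
    by case: (ht erefl) => // -[_ wu]; exact: ancestor_connect uC.
  by left; exists s'.
elim=> {v b} [|v [] w _ IH vC vw|v w _ IH vC vw|v w _ IH vC vw].
- by left; exists [:: a]; exact: spath_start.
- by case: IH => [[s sp]|[_ [s sp]]]; exact: down sp _ _.
- by case: IH => [[s sp]|[_ [s sp]]]; exact: down sp _ _.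
- by case: IH => [[s sp]|[av [s sp]]]; [exact: up sp _ _|exact: coll sp _ _].
- case: IH => [[s sp]|[]]; last by rewrite vC.
  by apply: (coll _ _ _ sp) => //; exists v.
Qed.

Lemma active_path_cons D C x y r : active_path D C [:: x, y & r] <->
  [/\ active_path D C (y :: r), x \notin y :: r, adjacent D x y &
    if r is z :: _ then
      if ((x, y) \in D) && ((z, y) \in D) then ancestor_of D C y else y \notin C
    else True].
Proof.
split.
- case=> /= /andP[xr us] /andP[xy pr] hk; split=> //.
    split=> // -[|k] // _ ks; have := hk k.+2 isT ks.
    by rewrite /= !(set_nth_default y x)//; do ![exact: ltnW|move: ks => /ltnW].
  by case: r xr us pr hk => // z r xr us pr hk; exact: (hk 1%N).
- case=> -[us pr hk] xr xy hc; split; [by rewrite cons_uniq xr|exact/andP|].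
  case=> [|[|k]] // _ ks; last first.
    by have := hk k.+1 isT ks; rewrite /= !(set_nth_default x y)//; do ![exact: ltnW|move: ks => /ltnW].
  by case: r us pr hk hc ks xr.
Qed.

(** The last clause keeps the orientation of the final edge, which decides whether [v] becomes a
    collider once the path is extended. *)
Lemma spath_active D C a s v b : is_dag D -> spath D C a s v b ->
  exists r, [/\ s = v :: r, active_path D C s, last a s = a &
    if r is u :: _ then (if b then (u, v) \in D else (v, u) \in D) else ~~ b].
Proof.
move=> dD; elim=> {s v b} [|s v b w sp IH vC vw ws|s v w sp IH vC vw ws|s v w sp IH vC vw ws].
- by exists [::]; split => //; split => // -[].
- have [r [E ac la hr]] := IH; exists (v :: r); rewrite E; split=> //; last by rewrite -[RHS]la E.
  apply/active_path_cons; rewrite -E; split=> //; first by rewrite /adjacent vw orbT.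
  by case: r E hr => // z r _ _; rewrite (negPf (dag_asym dD vw)).
- have [r [E ac la hr]] := IH; exists (v :: r); rewrite E; split=> //; last by rewrite -[RHS]la E.
  apply/active_path_cons; rewrite -E; split=> //; first by rewrite /adjacent vw.
  by case: r E hr => // z r _ /(dag_asym dD)/negPf->; rewrite andbF.
- have [r [E ac la hr]] := IH; exists (v :: r); rewrite E; split=> //; last by rewrite -[RHS]la E.
  apply/active_path_cons; rewrite -E; split=> //; first by rewrite /adjacent vw.
  by case: r E hr => // z r _ ->; rewrite vw.
Qed.

(** The detour through an open collider: descend to the first vertex in [C], turn there, and climb
    back. The vertices in between lie outside [C], so they can be passed in both directions. *)
Lemma reach_ancestor D C a v w : ancestor_of D C v -> reach D C a v true -> (w, v) \in D ->
  reach D C a w false.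
Proof.
case=> c cC /connectP[r]; elim: r v w => /= [|x r IH] v w.
  by move=> _ E rv wv; apply: reach_collider rv _ wv; rewrite -E.
case/andP => vx pr E rv wv; have [vC|vC] := boolP (v \in C).
  exact: reach_collider rv vC wv.
apply: (reach_up _ vC wv); apply: (IH x) => //; exact: reach_down rv vC vx.
Qed.

Lemma active_reach D C v r : is_dag D -> last v r \notin C -> active_path D C (v :: r) ->
  exists2 b, reach D C (last v r) v b &
   if r is u :: _ then (if b then (u, v) \in D else (v, u) \in D) else ~~ b.
Proof.
move=> dD; elim: r v => /= [|u r IH] v; first by exists false => //; exact: reach_start.
move=> lC /active_path_cons[ac vr vu hc]; have [b rb hb] := IH _ lC ac.
have [uv|uv] := boolP ((u, v) \in D).
  exists true => //; suff uC : u \notin C by exact: reach_down rb uC uv.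
  by case: r hc hb lC {IH rb ac vr} => // z r; rewrite (negPf (dag_asym dD uv)).
have {}vu : (v, u) \in D by move: vu; rewrite /adjacent (negPf uv) orbF.
exists false => //; case: r hc hb lC rb {IH ac vr} => [|z r].
  by case: b => // _ _ uC rb; exact: reach_up rb uC vu.
rewrite vu /=; case: b => [+ zu|]; first rewrite zu => av _ rb; first exact: reach_ancestor av rb vu.
move=> + /(dag_asym dD)/negPf zu; rewrite zu => uC _ rb.
exact: reach_up rb uC vu.
Qed.

Lemma d_separatedP D (A B C : {set 'I_p}) : is_dag D -> disjoint (mem B) (mem C) ->
  d_separated D A B C <-> forall a b t, a \in A -> b \in B -> ~ reach D C b a t.
Proof.
move=> dD BC; split.
- move=> ds a b t aA bB rab; apply: ds.
  have bC : b \notin C by rewrite (disjointFr BC).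
  suff [s [t' sp]] : exists s t', spath D C b s a t'.
    have [r [E ac la _]] := spath_active dD sp.
    exists s, a, b; split => //; rewrite E // -la E //.
  have := reach_spath dD bC rab; case: (t).
    by case=> [[s sp]|[_ [s sp]]]; [exists s, true|exists s, false].
  by case=> [[s sp]|[_ [s sp]]]; [exists s, false|exists s, true].
- move=> nr [s [a [b [aA bB]]]]; case: s => // v r /= va lb ac; rewrite -{}va in aA lb.
  have bC : last v r \notin C by rewrite lb (disjointFr BC).
  have [t rt _] := active_reach dD bC ac.
  by move: rt; rewrite lb => /nr; exact.
Qed.

Lemma d_separated_single D i j C : is_dag D -> j \notin C ->
  d_separated D [set i] [set j] C <-> forall t, ~ reach D C j i t.
Proof.
move=> dD jC; rewrite d_separatedP//; last by rewrite disjoints1.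
by split=> [h t|h a b t]; [apply: h; rewrite inE|rewrite !inE => /eqP-> /eqP->; exact: h].
Qed.

(** * Covered edge reversal *)

Lemma mem_reverse_edge D i j u v :
  ((u, v) \in reverse_edge D i j) =
  ((u == j) && (v == i)) || (((u, v) \in D) && ~~ ((u == i) && (v == j))).
Proof. by rewrite !inE !xpair_eqE andbC orbC. Qed.

Lemma mem_parents D u v : (u \in parents D v) = ((u, v) \in D).
Proof. by rewrite inE. Qed.

Lemma coveredP D i j : covered D i j ->
  (i, j) \in D /\ forall x, x != i -> ((x, i) \in D) = ((x, j) \in D).
Proof.
case=> ij E; split=> // x xi.
by move/setP/(_ x): E; rewrite !inE xi.
Qed.

Lemma reverse_is_dag D i j : is_dag D -> covered D i j -> is_dag (reverse_edge D i j).
Proof.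
move=> dD /coveredP[ij cov].
(* Doubling the ranks leaves room to put [j] at the old level of [i] and [i] just above it. Other
   parents of [j] are parents of [i], hence strictly below; children of [i] other than [j] lie at
   least two levels up. *)
pose h v := if v == j then (rank D i).*2 else if v == i then (rank D i).*2.+1 else (rank D v).*2.
have ji : j == i = false by rewrite eq_sym (negPf (dag_neq dD ij)).
apply: (@dag_of_rank _ h) => u v; rewrite mem_reverse_edge.
case/orP => [/andP[/eqP-> /eqP->]|/andP[uv nij]].
  by rewrite /h eqxx eq_sym ji eqxx.
have rij := rank_lt dD ij; have ruv := rank_lt dD uv.
rewrite /h; have [uj|uj] := eqVneq u j.
  have -> : (v == j) = false by rewrite -uj eq_sym (negPf (dag_neq dD uv)).
  have -> : (v == i) = false.
    by apply/negP => /eqP vi; move: uv; rewrite uj vi; apply/negP; exact: dag_asym.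
  by rewrite ltn_double; apply: ltn_trans rij _; rewrite -uj.
have [ui|ui] := eqVneq u i.
  have vj : (v == j) = false by move: nij; rewrite ui eqxx => /negPf.
  rewrite vj; have -> : (v == i) = false by rewrite -ui eq_sym (negPf (dag_neq dD uv)).
  by rewrite -ui; lia.
have [vj|vj] := eqVneq v j.
  by rewrite ltn_double rank_lt// cov// -vj.
have [vi|vi] := eqVneq v i; last by rewrite ltn_double.
by rewrite -vi; lia.
Qed.

Lemma covered_reverse D i j : is_dag D -> covered D i j -> covered (reverse_edge D i j) j i.
Proof.
move=> dD /coveredP[ij cov]; have ne := dag_neq dD ij.
split; first by rewrite mem_reverse_edge !eqxx.
apply/setP => x; rewrite finset.in_setD1 !mem_parents !mem_reverse_edge.
have [->|xj] := eqVneq x j; first by rewrite [j == i]eq_sym (negPf ne) /= (negPf (dag_noloop _ dD)).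
have [->|xi] /= := eqVneq x i.
  by rewrite eqxx (negPf (dag_noloop _ dD)) /= andbF.
by rewrite cov ?andbT.
Qed.

Lemma reverse_edgeK D i j : is_dag D -> covered D i j ->
  reverse_edge (reverse_edge D i j) j i = D.
Proof.
move=> dD [ij _]; have ne := dag_neq dD ij; apply/setP => -[u v].
rewrite !mem_reverse_edge.
have [/andP[/eqP-> /eqP->]|_] /= := boolP ((u == i) && (v == j)); first by rewrite ij.
have [/andP[/eqP-> /eqP->]|_] /= := boolP ((u == j) && (v == i)); last by rewrite !andbT.
by rewrite (negPf (dag_asym dD ij)).
Qed.

(** Since [i] and [j] have the same outside parents, a step from such a parent into one endpoint has
    a twin into the other. A walk in the reversed graph can therefore keep pace, except that at [i]
    and [j] it may arrive at the other endpoint or with the other flag; this is why only some flag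
    is claimed. *)
Lemma reverse_reach D C i j a v b : is_dag D -> covered D i j -> a \notin C ->
  reach D C a v b -> exists b', reach (reverse_edge D i j) C a v b'.
Proof.
move=> dD cv aC; have [ij cov] := coveredP cv; have ne := dag_neq dD ij.
have ji : (j == i) = false by rewrite eq_sym (negPf ne).
set D' := reverse_edge D i j; pose R := reach D' C a.
have dD' : is_dag D' by exact: reverse_is_dag.
have eji : (j, i) \in D' by rewrite mem_reverse_edge !eqxx.
have eD u w : (u, w) \in D -> (u != i) || (w != j) -> (u, w) \in D'.
  by move=> uw h; rewrite mem_reverse_edge uw negb_and h orbT.
have pai x : (x, i) \in D -> (x, j) \in D.
  by move=> xi; rewrite -cov// (dag_neq dD xi).
(* What a walk of [D] ending at [v] provides in the reversed graph. *)
pose sim v b :=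
  if v == i then
    if b then R i true /\ R j true
    else [\/ R i false, R j false /\ j \notin C | [/\ R i true, R j true & j \in C]]
  else if v == j then
    if b then [\/ R j true /\ R i true, R i false /\ i \notin C | R j false /\ j \notin C]
    else R j false
  else R v b.
suff H : forall v b, reach D C a v b -> sim v b.
  move=> /H; rewrite /sim; have [->|vi] := eqVneq v i.
    case: b => [[h _]|[h|[h jC]|[h _ _]]]; [by exists true|by exists false| |by exists true].
    by exists true; exact: reach_down h jC eji.
  have [->|vj] := eqVneq v j; last by exists b.
  case: b => [[[h _]|[h iC]|[h _]]|h]; [by exists true| |by exists false|by exists false].
  by exists false; exact: reach_up h iC eji.
have Rd u t w : R u t -> u \notin C -> (u, w) \in D -> (u != i) || (w != j) -> R w true.
  by move=> ru uC uw h; exact: reach_down ru uC (eD _ _ uw h).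
have Ru u w : R u false -> u \notin C -> (w, u) \in D -> (w != i) || (u != j) -> R w false.
  by move=> ru uC uw h; exact: reach_up ru uC (eD _ _ uw h).
have Rc u w : R u true -> u \in C -> (w, u) \in D -> (w != i) || (u != j) -> R w false.
  by move=> ru uC uw h; exact: reach_collider ru uC (eD _ _ uw h).
(* Only parents common to [i] and [j] point into [i]. *)
have into u t w : u != i -> u != j -> R u t -> u \notin C -> (u, w) \in D -> sim w true.
  move=> ui uj ru uC uw; rewrite /sim; have [E|wi] := eqVneq w i.
    rewrite E in uw; split; first by apply: Rd ru uC uw _; rewrite ui.
    by apply: Rd ru uC (pai _ uw) _; rewrite ui.
  have [E|wj] := eqVneq w j; last by apply: Rd ru uC uw _; rewrite ui.
  rewrite E in uw; constructor 1; split; first by apply: Rd ru uC uw _; rewrite ui.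
  by apply: (Rd _ _ _ ru uC); rewrite ?ui// cov.
have outof w : w != i -> w != j -> R w false -> sim w false.
  by move=> wi wj; rewrite /sim (negPf wi) (negPf wj).
move=> {}v {}b; elim=> {v b} [|v b w _ IH vC vw|v w _ IH vC wv|v w _ IH vC wv].
- rewrite /sim; have [<-|ai] := eqVneq a i; first by constructor 1; exact: reach_start.
  by have [<-|aj] := eqVneq a j; exact: reach_start.
- move: IH; rewrite {1}/sim; have [vi|vi] := eqVneq v i.
    have wi : w != i by rewrite eq_sym -vi (dag_neq dD vw).
    rewrite vi in vC vw => S; rewrite /sim (negPf wi); have [wj|wj] := eqVneq w j.
      case: b S => [[h1 h2]|[h|[h h']|[h1 h2 _]]]; by [constructor 1|constructor 2|constructor 3].
    have go t : R i t -> R w true by move=> h; apply: (Rd _ _ _ h vC vw); rewrite wj orbT.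
    case: b S => [[h1 h2]|[h|[h h']|[h1 h2 _]]]; [exact: go h1|exact: go h| |exact: go h1].
    exact: go (reach_down h h' eji).
  have [vj|vj] := eqVneq v j; last by move=> h; exact: into h vC vw.
  rewrite vj in vC vw; have wj : w != j by rewrite eq_sym (dag_neq dD vw).
  have wi : w != i by apply: contraTneq vw => ->; exact: dag_asym.
  have go t : R j t -> R w true by move=> h; apply: (Rd _ _ _ h vC vw); rewrite wj orbT.
  rewrite /sim (negPf wi) (negPf wj); case: b => [[[h1 h2]|[h iC]|[h _]]|h].
  + exact: go h1.
  + exact: go (reach_up h iC eji).
  + exact: go h.
  + exact: go h.
- move: IH; rewrite {1}/sim; have [vi|vi] := eqVneq v i.
    rewrite vi in vC wv => S; have wi : w != i by rewrite (dag_neq dD wv).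
    have wj : w != j by apply: contraTneq wv => ->; exact: dag_asym.
    apply: outof => //; case: S => [h|[h h']|[h1 h2 h']].
    + by apply: Ru h vC wv _; rewrite wi.
    + by apply: Ru h h' (pai _ wv) _; rewrite wi.
    + by apply: Rc h2 h' (pai _ wv) _; rewrite wi.
  have [vj|vj] := eqVneq v j.
    rewrite vj in vC wv => h; have wj : w != j by rewrite (dag_neq dD wv).
    rewrite /sim (negPf wj); have [wi|wi] := eqVneq w i; first by constructor 2.
    by apply: Ru h vC wv _; rewrite wi.
  move=> h; have := Ru _ _ h vC wv; rewrite vj orbT => /(_ isT).
  rewrite /sim; have [->|wi] := eqVneq w i; first by constructor 1.
  by have [->|wj] := eqVneq w j.
- move: IH; rewrite {1}/sim; have [vi|vi] := eqVneq v i.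
    rewrite vi in vC wv => -[h1 h2]; have wi : w != i by rewrite (dag_neq dD wv).
    have wj : w != j by apply: contraTneq wv => ->; exact: dag_asym.
    by apply: outof => //; apply: Rc h1 vC wv _; rewrite wi.
  have [vj|vj] := eqVneq v j.
    rewrite vj in vC wv; have wj : w != j by rewrite (dag_neq dD wv).
    rewrite {1}/sim (negPf wj); have [wi|wi] := eqVneq w i.
      by case=> [[h1 h2]|[h _]|[_]]; [constructor 3|constructor 1|rewrite vC].
    have wiD : (w, i) \in D by rewrite cov.
    case=> [[h1 h2]|[h iC]|[_]]; last by rewrite vC.
      by apply: Rc h1 vC wv _; rewrite wi.
    by apply: Ru h iC wiD _; rewrite wi.
  move=> h; have := Rc _ _ h vC wv; rewrite vj orbT => /(_ isT).
  rewrite /sim; have [->|wi] := eqVneq w i; first by constructor 1.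
  by have [->|wj] := eqVneq w j.
Qed.

Lemma reverse_d_separated D i j (A B C : {set 'I_p}) : is_dag D -> covered D i j ->
  disjoint (mem B) (mem C) ->
  d_separated D A B C <-> d_separated (reverse_edge D i j) A B C.
Proof.
move=> dD cv BC; have dD' := reverse_is_dag dD cv.
rewrite !d_separatedP//; split=> H a b t aA bB r.
  have bC : b \notin C by rewrite (disjointFr BC).
  have := reverse_reach dD' (covered_reverse dD cv) bC r.
  by rewrite reverse_edgeK// => -[t' /H]; exact.
have bC : b \notin C by rewrite (disjointFr BC).
by have [t' /H] := reverse_reach dD cv bC r; exact.
Qed.
(** * Markov equivalence *)

Lemma adjacent_not_separated D i j C : i != j -> adjacent D i j -> ~ d_separated D [set i] [set j] C.
Proof.
move=> ij a; apply; exists [:: i; j], i, j; split; rewrite ?inE//.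
by apply/active_path_cons; split=> //; rewrite inE.
Qed.

Lemma active_triple D C i k j : i != j -> i != k -> k != j -> adjacent D i k -> adjacent D k j ->
  (if ((i, k) \in D) && ((j, k) \in D) then k \in C else k \notin C) ->
  ~ d_separated D [set i] [set j] C.
Proof.
move=> ij ik kj aik akj h; apply; exists [:: i; k; j], i, j; split; rewrite ?inE//.
apply/active_path_cons; split=> //.
- by apply/active_path_cons; split=> //; rewrite inE.
- by rewrite !inE negb_or ik.
- by move: h; case: ifP => // _ kC; exists k; rewrite ?connect0.
Qed.

Lemma reach_into D C a v b : reach D C a v b -> b -> exists2 u, u \notin C & (u, v) \in D.
Proof. by case=> // u b' w _ uC uw _; exists u. Qed.

Lemma nonadjacent_separated D i j : is_dag D -> i != j -> ~~ adjacent D i j ->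
  ~~ connect (edge_rel D) j i ->
  [/\ i \notin parents D j, j \notin parents D j & d_separated D [set j] [set i] (parents D j)].
Proof.
move=> dD ij; rewrite /adjacent negb_or => /andP[nij nji] nc.
have ip : i \notin parents D j by rewrite mem_parents.
split=> //; first by rewrite mem_parents dag_noloop.
apply/d_separated_single => // t.
have H v b : reach D (parents D j) i v b -> b = false -> ~~ connect (edge_rel D) j v.
  elim=> {v b} // [v w _ IH vC wv|v w _ _ vC wv] _.
  - by apply: contraNN (IH erefl) => jw; exact: connect_trans jw (edge_connect wv).
  - apply/negP => jw; move: vC; rewrite mem_parents => /dD.
    by rewrite (connect_trans jw (edge_connect wv)).
case: t => r; last by have := H _ _ r erefl; rewrite connect0.
have [u] := reach_into r erefl; rewrite mem_parents => nu uj.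
by rewrite uj in nu.
Qed.

(** Restricted to disjoint triples because faithfulness speaks only about these. *)
Definition same_d_separation D D' := forall A B C : {set 'I_p}, disjoint (mem A) (mem B) ->
  disjoint (mem A) (mem C) -> disjoint (mem B) (mem C) -> (d_separated D A B C <-> d_separated D' A B C).

Lemma same_d_separation_sym D D' : same_d_separation D D' -> same_d_separation D' D.
Proof. by move=> h A B C *; symmetry; exact: h. Qed.

Lemma disjoint_single i j : i != j -> disjoint (mem [set i]) (mem [set j]).
Proof. by move=> ij; rewrite disjoints1 inE. Qed.

(** The separator is the parent set of whichever endpoint is not an ancestor of the other, so the
    pair comes back in an order that depends on the graph. *)
Lemma nonadjacent_separator D D' i j : is_dag D -> same_d_separation D D' -> i != j -> ~~ adjacent D i j ->
  exists u v C, [/\ (u, v) = (i, j) \/ (u, v) = (j, i), u \notin C, v \notin C,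
    d_separated D [set u] [set v] C & d_separated D' [set u] [set v] C].
Proof.
move=> dD eq.
wlog nc : i j / ~~ connect (edge_rel D) j i.
  move=> W ij na; have [jC|] := boolP (connect (edge_rel D) j i); last by move/W; exact.
  have [|||u [v [C [uv *]]]] := W j i; rewrite 1?eq_sym 1?adjacentC//.
    apply/negP => cij; have := rank_connect dD cij ij.
    by rewrite ltnNge ltnW// rank_connect// eq_sym.
  by exists u, v, C; split => //; case: uv; [right|left].
move=> ij na; have [iC jC ds] := nonadjacent_separated dD ij na nc.
exists j, i, (parents D j); split=> //; first by right.
have ji : disjoint (mem [set j]) (mem [set i]) by apply: disjoint_single; rewrite eq_sym.
by apply/eq; rewrite // disjoints1.
Qed.

(** Adjacent vertices are separated by no set and nonadjacent ones by some parent set, so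
    separations determine adjacency. *)
Lemma same_skeleton D D' i j : is_dag D -> is_dag D' -> same_d_separation D D' ->
  adjacent D i j = adjacent D' i j.
Proof.
move=> dD dD' eq.
have H E E' : is_dag E -> is_dag E' -> same_d_separation E E' -> adjacent E' i j -> adjacent E i j.
  move=> dE dE' eqE a; apply/negPn/negP => na.
  have ij : i != j by case/orP: a => /(dag_neq dE') //; rewrite eq_sym.
  have [u [v [C [[] [-> ->] _ _ _]]]] := nonadjacent_separator dE eqE ij na.
    exact: adjacent_not_separated.
  by apply: adjacent_not_separated; rewrite 1?eq_sym 1?adjacentC.
by apply/idP/idP; apply: H => //; exact: same_d_separation_sym.
Qed.

(** A set separating [i] from [j] in [D] must avoid the collider [k]. If [k] were not a collider in
    [D'], the path through [k] would be open given that same set. *)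
Lemma same_immorality D D' i j k : is_dag D -> is_dag D' -> same_d_separation D D' -> i != j ->
  (i, k) \in D -> (j, k) \in D -> ~~ adjacent D i j -> (i, k) \in D' /\ (j, k) \in D'.
Proof.
move=> dD dD' eq ij ik jk na.
have nik := dag_neq dD ik; have njk := dag_neq dD jk.
have aik : adjacent D i k by rewrite /adjacent ik.
have ajk : adjacent D j k by rewrite /adjacent jk.
apply/andP/negPn/negP => nv.
have H u v C : u \notin C -> v \notin C -> (u, v) = (i, j) \/ (u, v) = (j, i) ->
    d_separated D [set u] [set v] C -> d_separated D' [set u] [set v] C -> False.
  move=> uC vC uv ds ds'; have kC : k \notin C.
    apply/negP => kC; case: uv ds => -[-> ->]; apply: (@active_triple _ _ _ k);
      rewrite ?ik ?jk ?(adjacentC _ k) // eq_sym//.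
  case: uv ds' => -[-> ->]; apply: (@active_triple _ _ _ k);
    rewrite ?(adjacentC _ k) -?(same_skeleton _ _ dD dD' eq)// ?[_ == i]eq_sym ?[_ == j]eq_sym//.
  - by rewrite (negPf nv).
  - by rewrite eq_sym.
  - by rewrite andbC (negPf nv).
have [u [v [C [uv uC vC ds ds']]]] := nonadjacent_separator dD eq ij na.
exact: H uC vC uv ds ds'.
Qed.

(* Chickering's choice of an edge to reverse: [j] is a lowest vertex with a reversed incoming edge, [i] its highest reversed parent. *)
Lemma covered_reversed_edge D D' : is_dag D -> is_dag D' -> same_d_separation D D' -> D <> D' ->
  exists i j, covered D i j /\ (j, i) \in D'.
Proof.
move=> dD dD' eq DD'.
have sk u v := @same_skeleton D D' u v dD dD' eq.
have flip u v : (u, v) \in D -> (u, v) \notin D' -> (v, u) \in D'.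
  by move=> uv nuv; have := sk u v; rewrite /adjacent uv (negPf nuv) /= => <-.
pose rev u v := ((u, v) \in D) && ((v, u) \in D').
have [[u0 v0] uv0] : exists e, rev e.1 e.2.
  have : ~~ (D \subset D').
    apply/negP => /fintype.subsetP sub; apply: DD'; apply/setP => -[u v].
    apply/idP/idP => [|uv']; first exact: sub.
    have := sk u v; rewrite /adjacent uv' => /orP[//|/sub vu'].
    by rewrite (negPf (dag_asym dD' uv')) in vu'.
  case/subsetPn => -[u v] uv nuv; exists (u, v); rewrite /rev /= uv; exact: flip.
have ex0 : [exists u, rev u v0] by apply/existsP; exists u0.
case: (@arg_minnP _ v0 [pred v | [exists u, rev u v]] (rank D) ex0) => j /existsP[u1 ur] jmin.
case: (@arg_maxnP _ u1 [pred u | rev u j] (rank D) ur) => i /= /andP[ij ji'] imax.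
have nrev u v : (u, v) \in D -> rank D v < rank D j -> (u, v) \in D'.
  move=> uv rv; apply/negPn/negP => nuv; have := jmin v.
  rewrite inE leqNgt rv => h; apply: notF; apply: h; apply/existsP; exists u.
  by rewrite /rev uv flip.
have rij := rank_lt dD ij.
exists i, j; split=> //; split=> //; apply/setP => k; rewrite finset.in_setD1 !mem_parents.
apply/idP/andP => [ki|[ki kj]].
  have kni := dag_neq dD ki; split => //.
  have ki' := nrev _ _ ki rij.
  have kj : k != j by apply: contraTneq ki => ->; exact: dag_asym.
  (* Otherwise [k -> i <- j] would be an immorality of [D'], and transferring it to [D] would
     contradict [i -> j]. *)
  have : adjacent D k j.
    apply/negPn/negP => na; have := same_immorality dD' dD (same_d_separation_sym eq) kj ki' ji'.
    rewrite -sk => /(_ na)[_] /(dag_asym dD).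
    by rewrite ij.
  case/orP => // jk; have := rank_lt dD jk; rewrite ltnNge ltnW//.
  exact: ltn_trans (rank_lt dD ki) rij.
(* Otherwise [k -> j <- i] would be an immorality of [D], and transferring it to [D'] would
   contradict [j -> i]. *)
have : adjacent D k i.
  apply/negPn/negP => na; have [_ ij'] := same_immorality dD dD' eq ki kj ij na.
  by rewrite (negPf (dag_asym dD' ji')) in ij'.
(* If [i -> k], minimality of [j] keeps this edge in [D'] and maximality of [i] keeps [k -> j];
   together with [j -> i] they form a cycle in [D']. *)
case/orP => // ik; have rik := rank_lt dD ik; have rkj := rank_lt dD kj.
have ik' := nrev _ _ ik rkj.
have kj' : (k, j) \in D'.
  apply/negPn/negP => nkj; have := imax k; rewrite /= /rev kj flip// leqNgt rik.
  by move/(_ isT).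
by have := dD' _ _ ik'; rewrite (connect_trans (edge_connect kj') (edge_connect ji')).
Qed.

(** * Topological orders *)

(** Latest vertices come first: each vertex is followed by all its parents, so a tail of the list
    contains every parent of the vertex in front of it. *)
Definition topological D s := [/\ uniq s, forall v, v \in s & pairwise (fun v u => (v, u) \notin D) s].

Lemma topological_parents D s1 s2 u v : is_dag D -> topological D (s1 ++ v :: s2) -> (u, v) \in D -> u \in s2.
Proof.
move=> dD [us alls]; rewrite pairwise_cat => /and3P[/allrelP pw _ _] uv.
have := alls u; rewrite mem_cat inE => /or3P[us1|/eqP E|//].
  by have := pw u v us1 (mem_head _ _); rewrite uv.
by have := dag_noloop v dD; rewrite -{1}E uv.
Qed.

Lemma topological_index D s u v : is_dag D -> topological D s -> (u, v) \in D -> index v s < index u s.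
Proof.
move=> dD ts uv; have vs : v \in s by case: ts.
case/path.splitPr: vs ts => s1 s2 ts; have us2 := topological_parents dD ts uv.
case: ts => us _ _; move: us; rewrite cat_uniq /= negb_or => /and3P[_ /andP[v1 hs] /andP[v2 _]].
have u1 : u \notin s1 by apply/negP => u1; move/hasPn: hs => /(_ _ us2); rewrite u1.
rewrite !index_cat (negPf v1) (negPf u1) ltn_add2l /= eqxx.
by rewrite eq_sym (negPf (dag_neq dD uv)).
Qed.

Definition by_rank D := sort (fun u v => rank D v <= rank D u) (enum 'I_p).

Lemma by_rank_topological D : is_dag D -> topological D (by_rank D).
Proof.
move=> dD; split; first by rewrite sort_uniq enum_uniq.
  by move=> v; rewrite mem_sort mem_enum.
have tr : transitive (fun u v => rank D v <= rank D u) by move=> a b c h1 h2; exact: leq_trans h2 h1.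
have : sorted (fun u v => rank D v <= rank D u) (by_rank D).
  by apply: sort_sorted => u v; exact: leq_total.
rewrite sorted_pairwise//; apply: sub_pairwise => u v /= h.
by apply/negP => /(rank_lt dD); rewrite ltnNge h.
Qed.

(** Vertices of rank above that of [i] go before [j] and the others after [i]. Coveredness makes
    this legal: a parent of [j] other than [i] is a parent of [i] and so has lower rank. *)
Lemma topological_covered D i j : is_dag D -> covered D i j ->
  exists s1 s2, topological D (s1 ++ j :: i :: s2).
Proof.
move=> dD /coveredP[ij cov]; have ne := dag_neq dD ij; have rij := rank_lt dD ij.
have [uq al pw] := by_rank_topological dD.
exists [seq v <- by_rank D | (rank D i < rank D v) && (v != j)].
exists [seq v <- by_rank D | (rank D v <= rank D i) && (v != i)].
have nlt u v : rank D v <= rank D u -> (u, v) \notin D.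
  by move=> h; apply/negP => /(rank_lt dD); rewrite ltnNge h.
split.
- rewrite cat_uniq /= !filter_uniq// !inE !mem_filter !eqxx !andbF /= ltnn /=.
  rewrite [rank D j <= _]leqNgt rij [j == i]eq_sym (negPf ne) /= !andbT.
  by apply/hasPn => x; rewrite !mem_filter => /andP[/andP[h _] _]; rewrite ltnNge h.
- move=> v; rewrite mem_cat !inE !mem_filter al.
  by case: (eqVneq v j) => _; case: (eqVneq v i) => _; rewrite ?orbT //= !andbT; case: ltnP.
rewrite pairwise_cat /= !pairwise_filter// !andbT.
have Hji : (j, i) \notin D by exact: dag_asym.
rewrite Hji /=; apply/and3P; split.
- apply/allrelP => u v; rewrite mem_filter !inE mem_filter => /andP[/andP[h uj] _].
  case/or3P => [/eqP->|/eqP->|/andP[/andP[h' _] _]]; last 2 first.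
  + by apply: nlt; exact: ltnW.
  + by apply: nlt; apply: leq_trans h' (ltnW h).
  have [ui|ui] := eqVneq u i; first by rewrite ui ltnn in h.
  by rewrite -cov//; apply: nlt; exact: ltnW.
- apply/allP => u; rewrite mem_filter => /andP[/andP[h _] _]; apply: nlt.
  exact: leq_trans h (ltnW rij).
- by apply/allP => u; rewrite mem_filter => /andP[/andP[h _] _]; exact: nlt.
Qed.
End Dag.

Import numFieldNormedType.Exports.
Local Open Scope classical_set_scope.
Local Open Scope ring_scope.

(** * Quadratic forms of recursive systems *)

Definition affine_fun (R : nzRingType) (g : R -> R) : Prop :=
  exists a b, forall y, g y = a * y + b.

Definition upd (T : eqType) (V : Type) (x : T -> V) (t : T) (y : V) : T -> V :=
  fun k => if k == t then y else x k.

(* Lists are read from the latest vertex to the earliest: the predecessors of the head are its tail. *)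
Fixpoint qform (T : eqType) (R : nzRingType) (mu : T -> R) (f : T -> T -> R -> R)
    (w : T -> R) (s : seq T) (x : T -> R) : R :=
  if s is v :: s' then
    w v * (x v - mu v - \sum_(k <- s') f v k (x k)) ^+ 2 + qform mu f w s' x
  else 0.

Section Qform.
Variables (T : eqType) (R : realFieldType).
Implicit Types (mu w : T -> R) (f : T -> T -> R -> R) (x : T -> R) (s u v : seq T).

Lemma upd_id x t y : upd x t y t = y. Proof. by rewrite /upd eqxx. Qed.

Lemma upd_neq x t y k : k != t -> upd x t y k = x k.
Proof. by rewrite /upd => /negPf->. Qed.

Lemma qform_eq_in mu f w s x y : {in s, x =1 y} -> qform mu f w s x = qform mu f w s y.
Proof.
elim: s => //= v s IH H; rewrite IH; last by move=> k ks; apply: H; rewrite inE ks orbT.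
rewrite H ?mem_head//; congr (_ * (_ - _) ^+ 2 + _).
by apply: eq_big_seq => k ks; rewrite H// inE ks orbT.
Qed.

Lemma qform_upd mu f w s x t y : t \notin s -> qform mu f w s (upd x t y) = qform mu f w s x.
Proof.
move=> ts; apply: qform_eq_in => k ks; rewrite upd_neq//.
by apply: contraNneq ts => <-.
Qed.

(** The terms of the common prefix depend on the later part of the list only through its set of
    vertices. *)
Lemma qform_cat_perm mu f w mu' f' w' u s s' x :
    {in u, mu =1 mu'} -> {in u, f =1 f'} -> {in u, w =1 w'} -> perm_eq s s' ->
    qform mu f w s x = qform mu' f' w' s' x ->
  qform mu f w (u ++ s) x = qform mu' f' w' (u ++ s') x.
Proof.
move=> Hmu Hf Hw ss' Hq; elim: u Hmu Hf Hw => //= a u IH Hmu Hf Hw.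
rewrite IH; [|by move=> r ru; apply: Hmu; rewrite inE ru orbT
  |by move=> r ru; apply: Hf; rewrite inE ru orbT
  |by move=> r ru; apply: Hw; rewrite inE ru orbT].
rewrite Hmu ?mem_head// Hw ?mem_head// Hf ?mem_head//.
by congr (_ * (_ - _) ^+ 2 + _); apply: perm_big; rewrite perm_cat2l.
Qed.

Lemma sum_upd (g : T -> R -> R) u t v x y : t \notin u ++ v ->
  \sum_(k <- u ++ t :: v) g k (upd x t y k) = g t y + \sum_(k <- u ++ v) g k (x k).
Proof.
move=> tuv; rewrite (perm_big (t :: u ++ v)); last by rewrite perm_catC /= perm_cons perm_catC.
rewrite big_cons upd_id; congr (_ + _); apply: eq_big_seq => k ks; rewrite upd_neq//.
by apply: contraNneq tuv => <-.
Qed.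

(** The leading coefficient is one constant for all [x], while the lower coefficients may vary with
    the remaining coordinates. This constancy is what forces affineness. *)
Definition quad_in (F : (T -> R) -> R) (t : T) : Prop :=
  exists alpha (beta gamma : (T -> R) -> R),
    forall x y, F (upd x t y) = alpha * y ^+ 2 + beta x * y + gamma x.

(* Peeling the latest vertex [c]: its coordinate enters linearly the increment of the form in [x c], so that increment is affine in [x t] only if [f c t] is. *)
Lemma quad_in_affine mu f w u t v : uniq (u ++ t :: v) -> (forall r, 0 < w r) ->
  quad_in (qform mu f w (u ++ t :: v)) t -> {in u, forall c, affine_fun (f c t)}.
Proof.
move=> + w0; elim: u => //= c u IH /andP[cnot uq] [al [be [ga H]]].
have ct : c != t by apply: contraNneq cnot => ->; rewrite mem_cat mem_head orbT.
have tuv : t \notin u ++ v.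
  move: uq; rewrite cat_uniq mem_cat /= => /and3P[_ /norP[tu _] /andP[tv _]].
  by rewrite negb_or; apply/andP.
have fE x y : w c * (x c - mu c - (f c t y + \sum_(k <- u ++ v) f c k (x k))) ^+ 2
    + qform mu f w (u ++ t :: v) (upd x t y) = al * y ^+ 2 + be x * y + ga x.
  by rewrite -H upd_neq// sum_upd.
have Hc : affine_fun (f c t).
  (* Subtracting the identities at [x c = 0] and [x c = 1] cancels both the common [al * y ^+ 2] and
     the part of the form that does not see [x c]. What remains is affine in [f c t y] on one side
     and affine in [y] on the other. *)
  pose x0 : T -> R := upd (fun=> 0) c 0; pose x1 : T -> R := upd (fun=> 0) c 1.
  have e0 y := fE x0 y; have e1 y := fE x1 y.
  pose S := \sum_(k <- u ++ v) f c k 0.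
  have S0 z : \sum_(k <- u ++ v) f c k (upd (fun=> 0) c z k) = S.
    apply: eq_big_seq => k ks; rewrite upd_neq//; apply: contraNneq cnot => <-.
    by move: ks; rewrite !mem_cat inE; case/orP => -> //; rewrite !orbT.
  have Q01 y : qform mu f w (u ++ t :: v) (upd x0 t y) = qform mu f w (u ++ t :: v) (upd x1 t y).
    apply: qform_eq_in => k ks; rewrite /x0 /x1 /upd; case: (k == t) => //.
    by case: (eqVneq k c) cnot => [<-|] //; rewrite ks.
  exists ((be x0 - be x1) / (2 * w c)).
  exists ((ga x0 - ga x1) / (2 * w c) + (1 - 2 * mu c) / 2 - S) => y.
  move: (e0 y) (e1 y); rewrite Q01 {1 2}/x0 {1 2}/x1 !upd_id !S0.
  set q := qform _ _ _ _ _ => h0 h1.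
  have wc := w0 c; have wn : w c != 0 by rewrite gt_eqF.
  have : w c * (1 - 2 * mu c - 2 * (f c t y + S)) = (be x1 - be x0) * y + (ga x1 - ga x0).
    rewrite [LHS](_ : _ = (w c * (1 - mu c - (f c t y + S)) ^+ 2 + q)
      - (w c * (0 - mu c - (f c t y + S)) ^+ 2 + q)); last by ring.
    by rewrite h0 h1; ring.
  move=> h2.
  have -> : f c t y = ((1 - 2 * mu c - 2 * S) - (1 - 2 * mu c - 2 * (f c t y + S))) / 2.
    by field.
  have -> : 1 - 2 * mu c - 2 * (f c t y + S) = ((be x1 - be x0) * y + (ga x1 - ga x0)) / w c.
    by rewrite -h2; field.
    by field.
move=> r; rewrite inE => /orP[/eqP->//|]; apply: IH => //.
have [a [b ab]] := Hc.
(* With [f c t] affine, [A x - a * y] is the residual of [c]; removing its weighted square leaves a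
   quadratic in [y] whose leading coefficient is again constant. *)
pose A x := x c - mu c - b - \sum_(k <- u ++ v) f c k (x k).
exists (al - w c * a ^+ 2), (fun x => be x + 2 * (w c * a * A x)), (fun x => ga x - w c * A x ^+ 2).
move=> x y; have := fE x y; rewrite ab -[X in _ * X ^+ 2 + _](_ : A x - a * y = _); last first.
  by rewrite /A; ring.
by move=> e; rewrite -[LHS](addKr (w c * (A x - a * y) ^+ 2)) e; ring.
Qed.

(** Completing the square in [x t] in the two terms of [c] and [t]: algebraically this is the
    regression of [t] on [c]. Only the functions at [c] and [t] change. *)
Lemma qform_swap mu f w u c t v : uniq (u ++ c :: t :: v) -> (forall r, 0 < w r) ->
    affine_fun (f c t) ->
  exists mu' f' w' a, [/\ forall r, 0 < w' r,
    forall x, qform mu' f' w' (u ++ t :: c :: v) x = qform mu f w (u ++ c :: t :: v) x,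
    forall r, r != c -> r != t -> f' r = f r,
    forall k y, f' c k y = f c k y + a * f t k y & affine_fun (f' t c)].
Proof.
rewrite cat_uniq /= !negb_or => /and5P[_ /and3P[cu tu _] /andP[ct cv] tv vq].
move=> w0 [a [b ab]].
(* [W] is the total coefficient of [x t ^+ 2] and [be] the regression coefficient of [t] on [c]. The
   new weight [w c * w t / W] of [c] is the inverse of [1 / w c + a ^+ 2 / w t], as for the variance
   of a sum. *)
pose W := w t + w c * a ^+ 2; pose be := w c * a / W.
have W0 : 0 < W by rewrite ltr_pwDl// mulr_ge0 ?sqr_ge0// ltW.
pose mc := mu c + b + a * mu t.
exists (fun r => if r == c then mc else if r == t then mu t - be * mc else mu r).
pose fc k y := f c k y + a * f t k y.
pose f' r k y := if r == c then fc k y else if r == t then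
  (if k == c then be * y else f t k y - be * fc k y) else f r k y.
exists f', (fun r => if r == c then w c * w t / W else if r == t then W else w r), a.
have tc : (t == c) = false by rewrite eq_sym (negPf ct).
split.
- move=> r; case: ifP => _; first by rewrite divr_gt0 ?mulr_gt0.
  by case: ifP.
- move=> x; apply: qform_cat_perm.
  + by move=> r ru /=; rewrite !ifN//; [apply: contraNneq tu|apply: contraNneq cu] => <-.
  + move=> r ru /=; apply: funext => k; apply: funext => y.
    by rewrite /f' !ifN//; [apply: contraNneq tu|apply: contraNneq cu] => <-.
  + by move=> r ru /=; rewrite !ifN//; [apply: contraNneq tu|apply: contraNneq cu] => <-.
  + by rewrite -[t :: _]/([:: t] ++ [:: c] ++ v) -[c :: t :: v]/([:: c] ++ [:: t] ++ v) perm_catCA.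
  rewrite /= !eqxx !tc !big_cons /f' !eqxx !tc ab addrA [RHS]addrA.
  congr (_ + _); last first.
    elim: v vq cv tv => //= r v IH /andP[rv vq].
    rewrite !inE !negb_or => /andP[cr cv] /andP[tr tv]; rewrite IH//.
    by rewrite ![r == _]eq_sym (negPf cr) (negPf tr).
  have -> : \sum_(k <- v) fc k (x k) = \sum_(k <- v) f c k (x k) + a * \sum_(k <- v) f t k (x k).
    by rewrite big_distrr -big_split.
  have -> : \sum_(k <- v) (if k == c then be * x k else f t k (x k) - be * fc k (x k)) =
     \sum_(k <- v) f t k (x k) - be * (\sum_(k <- v) f c k (x k) + a * \sum_(k <- v) f t k (x k)).
    rewrite [a * _]big_distrr/= -big_split/= big_distrr/= -sumrB; apply: eq_big_seq => k kv.
    by rewrite ifN//; apply: contraNneq cv => <-.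
  rewrite /be /mc /W; field.
  exact: lt0r_neq0.
- by move=> r /negPf rc /negPf rt; apply: funext => k; apply: funext => y; rewrite /f' rc rt.
- by move=> k y; rewrite /f' eqxx.
- by exists be, 0 => y; rewrite /f' tc !eqxx addr0.
Qed.

Lemma qform_move mu f w u0 u t v : uniq (u0 ++ u ++ t :: v) -> (forall r, 0 < w r) ->
    {in u, forall c, affine_fun (f c t)} ->
  exists mu' f' w', [/\ forall r, 0 < w' r,
    forall x, qform mu' f' w' (u0 ++ t :: u ++ v) x = qform mu f w (u0 ++ u ++ t :: v) x &
    forall r, r \notin u -> r != t -> f' r = f r].
Proof.
elim/last_ind: u v mu f w => [|u c IH] v mu f w; first by exists mu, f, w.
rewrite cat_rcons => uq w0 fa.
have uq' : uniq ((u0 ++ u) ++ c :: t :: v) by rewrite -catA.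
have fc : affine_fun (f c t) by apply: fa; rewrite mem_rcons mem_head.
have [mu1 [f1 [w1 [a [w10 q1 f1r f1c _]]]]] := qform_swap mu uq' w0 fc.
have uq1 : uniq (u0 ++ u ++ t :: c :: v).
  rewrite (perm_uniq (_ : perm_eq _ (u0 ++ u ++ c :: t :: v)))//.
  by rewrite !perm_cat2l -[t :: _]/([:: t] ++ [:: c] ++ v) -[c :: t :: v]/([:: c] ++ [:: t] ++ v) perm_catCA.
have fa1 : {in u, forall r, affine_fun (f1 r t)}.
  move=> r ru; rewrite f1r; first by apply: fa; rewrite mem_rcons inE ru orbT.
    apply: contraTneq uq' => <-; rewrite cat_uniq /= negb_or mem_cat ru orbT/=.
    by rewrite !andbF.
  apply: contraTneq uq' => <-; rewrite cat_uniq /= !negb_or !mem_cat ru !orbT/=.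
  by rewrite !andbF.
have [mu2 [f2 [w2 [w20 q2 f2r]]]] := IH (c :: v) mu1 f1 w1 uq1 w10 fa1.
exists mu2, f2, w2; split => //.
- by move=> x; rewrite cat_rcons q2 catA q1 -catA.
- move=> r; rewrite mem_rcons inE negb_or => /andP[rc ru] rt.
  by rewrite f2r// f1r.
Qed.

Lemma square_min_eq (p r A B a b : R) : 0 < p -> 0 < r ->
  (forall y, p * (y - A) ^+ 2 + a = r * (y - B) ^+ 2 + b) -> a = b.
Proof.
move=> p0 r0 H; move: (H A) (H B); rewrite !subrr expr0n /= !mulr0 !add0r => hA hB.
have := mulr_ge0 (ltW r0) (sqr_ge0 (A - B)); have := mulr_ge0 (ltW p0) (sqr_ge0 (B - A)).
lra.
Qed.

(* Minimising over the coordinate of the latest vertex leaves the form of the remaining ones. *)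
Lemma qform_drop_head mu f w mu' f' w' t s s' K : t \notin s -> t \notin s' ->
    (forall r, 0 < w r) -> (forall r, 0 < w' r) ->
    (forall x, qform mu f w (t :: s) x = qform mu' f' w' (t :: s') x + K) ->
  forall x, qform mu f w s x = qform mu' f' w' s' x + K.
Proof.
move=> ts ts' w0 w'0 q x.
have E y : w t * (y - (mu t + \sum_(k <- s) f t k (x k))) ^+ 2 + qform mu f w s x =
    w' t * (y - (mu' t + \sum_(k <- s') f' t k (x k))) ^+ 2 + (qform mu' f' w' s' x + K).
  have sE (h : T -> R -> R) u : t \notin u -> \sum_(k <- u) h k (upd x t y k) = \sum_(k <- u) h k (x k).
    move=> tu; apply: eq_big_seq => k ks; rewrite upd_neq//.
    by apply: contraNneq tu => <-.
  by have := q (upd x t y); rewrite /= upd_id !qform_upd// !sE// !opprD !addrA.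
exact: square_min_eq (w0 t) (w'0 t) E.
Qed.

(** The induction removes the head [t] of [s'], the latest vertex of the second model, from both
    forms. The index condition excludes [t = j], and it survives the removal unless [t = i], where
    affineness is immediate because [j] stands before [i] in the first list. *)
Theorem qform_reversed_affine s' s1 s2 i j mu f w mu' f' w' K :
    uniq s' -> perm_eq (s1 ++ j :: i :: s2) s' ->
    (forall r, 0 < w r) -> (forall r, 0 < w' r) ->
    (forall x, qform mu f w (s1 ++ j :: i :: s2) x = qform mu' f' w' s' x + K) ->
    (index i s' < index j s')%N ->
  affine_fun (f j i).
Proof.
elim: s' s1 s2 mu f w K => [|t s' IH] s1 s2 mu f w K //= /andP[ts' us'] ps w0 w'0 q lij.
have tj : t != j by apply: contraTneq lij => ->; rewrite eqxx.
have us : uniq (s1 ++ j :: i :: s2) by rewrite (perm_uniq ps) /= ts'.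
have fa u v : s1 ++ j :: i :: s2 = u ++ t :: v -> {in u, forall c, affine_fun (f c t)}.
  move=> E; apply: (quad_in_affine (mu := mu) (w := w) (v := v)) => //; first by rewrite -E.
  (* Seen through the second form, [x t] occurs only in the head term, so the leading coefficient is
     the constant [w' t]. *)
  pose A x := mu' t + \sum_(k <- s') f' t k (x k).
  exists (w' t), (fun x => - (2 * (w' t * A x))), (fun x => w' t * A x ^+ 2 + qform mu' f' w' s' x + K).
  move=> x y; rewrite -E q /= upd_id qform_upd//.
  rewrite (_ : \sum_(k <- s') _ = \sum_(k <- s') f' t k (x k)); last first.
    by apply: eq_big_seq => k ks; rewrite upd_neq//; apply: contraNneq ts' => <-.
  by rewrite /A; ring.
have [ti|ti] := eqVneq t i.
  by rewrite -ti; apply: (fa (rcons s1 j) s2); rewrite ?cat_rcons -?ti// mem_rcons mem_head.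
have lij' : (index i s' < index j s')%N by move: lij; rewrite (negPf tj) (negPf ti).
(* It suffices to move [t] to the front without disturbing the affineness of [f j i]. *)
have fin mu2 f2 w2 s1' s2' : (forall r, 0 < w2 r) -> perm_eq (t :: s1' ++ j :: i :: s2') (t :: s') ->
    (forall x, qform mu2 f2 w2 (t :: s1' ++ j :: i :: s2') x = qform mu f w (s1 ++ j :: i :: s2) x) ->
    affine_fun (f2 j i).
  move=> w20 p2 q2; apply: (IH s1' s2' mu2 f2 w2 K) => //; first by rewrite -(perm_cons t).
  apply: (qform_drop_head (t := t)) => //; last by move=> x; rewrite q2 q.
  have := perm_uniq p2; rewrite [in RHS]/= ts' us' => /=.
  by case/andP.
have : t \in s1 ++ j :: i :: s2 by rewrite (perm_mem ps) mem_head.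
rewrite mem_cat !inE (negPf tj) (negPf ti) /= => /orP[] ts.
  (* Here [t] is later than [j] and only moves past vertices later than itself, so [f j] is
     untouched. *)
  move: q ps us fa fin; case/path.splitPr: ts => u v; rewrite -catA /= => q ps us fa fin.
  have [mu1 [f1 [w1 [w10 q1 f1r]]]] := @qform_move mu f w [::] u t _ us w0 (fa _ _ erefl).
  have ju : j \notin u.
    move: us; rewrite cat_uniq => /and3P[_ /hasPn/(_ j) h _]; apply: h.
    by rewrite inE mem_cat mem_head !orbT.
  rewrite -(f1r j)// 1?eq_sym//; apply: (fin mu1 f1 w1 (u ++ v) s2) => //; rewrite -catA//.
  by apply: perm_trans ps; rewrite perm_sym -[t :: v ++ _]cat1s -[t :: u ++ _]cat1s perm_catCA.
(* Here [t] is earlier than [i]: it passes [u], then [i], then [j], and finally [s1]. Only the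
   passage of [j] alters [f j]. *)
move: q ps us fa fin; case/path.splitPr: ts => u v => q ps us fa fin.
have sE : s1 ++ j :: i :: u ++ t :: v = (s1 ++ [:: j, i & u]) ++ t :: v by rewrite -catA.
have fa1 := fa _ _ sE.
have us1 : uniq ((s1 ++ [:: j; i]) ++ u ++ t :: v) by rewrite -catA.
have [|mu1 [f1 [w1 [w10 q1 f1r]]]] := @qform_move mu f w _ u t v us1 w0.
  by move=> c cu; apply: fa1; rewrite mem_cat !inE cu !orbT.
have [jt it] : j != t /\ i != t by rewrite ![_ == t]eq_sym.
move: (us); rewrite cat_uniq => /and3P[_ hs1]; rewrite [uniq _]/= !inE !negb_or !mem_cat !negb_or.
move=> /and3P[/and3P[ji ju _] /andP[iu _] _].
have out1 c : c \in s1 -> [/\ c != j, c != i, c != t & c \notin u].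
  move=> cs; have /hasPn h := hs1.
  have h' r : r \in [:: j, i & u ++ t :: v] -> c != r.
    by move=> rs; apply: contraTneq (h _ rs) => <-; rewrite negbK.
  split; [apply: h'..|]; rewrite ?inE ?mem_cat ?eqxx ?inE ?eqxx ?orbT//.
  by apply/negP => cu; have := h' c; rewrite !inE mem_cat cu !orbT eqxx => /(_ isT).
have p3 : perm_eq (s1 ++ t :: j :: i :: u ++ v) (s1 ++ j :: i :: u ++ t :: v).
  rewrite perm_cat2l perm_sym -[j :: i :: u ++ t :: v]/([:: j, i & u] ++ t :: v).
  by rewrite perm_catC /= perm_cons perm_catC.
have p2 : perm_eq (s1 ++ j :: t :: i :: u ++ v) (s1 ++ t :: j :: i :: u ++ v).
  by rewrite perm_cat2l -[j :: t :: _]/([:: j] ++ [:: t] ++ _) perm_catCA.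
have p1 : perm_eq (s1 ++ j :: i :: t :: u ++ v) (s1 ++ j :: t :: i :: u ++ v).
  by rewrite perm_cat2l perm_cons -[i :: t :: _]/([:: i] ++ [:: t] ++ _) perm_catCA.
have us3 : uniq (s1 ++ t :: j :: i :: u ++ v) by rewrite (perm_uniq p3).
have us2 : uniq (s1 ++ j :: t :: i :: u ++ v) by rewrite (perm_uniq p2).
have us1' : uniq (rcons s1 j ++ i :: t :: u ++ v) by rewrite cat_rcons (perm_uniq p1).
have [|mu2 [f2 [w2 [a2 [w20 q2 f2r f2i f2t]]]]] := qform_swap mu1 us1' w10 (f := f1).
  by rewrite f1r//; apply: fa1; rewrite mem_cat !inE eqxx !orbT.
have [|mu3 [f3 [w3 [a3 [w30 q3 f3r f3j _]]]]] := qform_swap mu2 us2 w20 (f := f2).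
  by rewrite f2r// f1r//; apply: fa1; rewrite mem_cat !inE eqxx !orbT.
have [|mu4 [f4 [w4 [w40 q4 f4r]]]] := @qform_move mu3 f3 w3 [::] s1 t _ us3 w30.
  move=> c cs; have [cj ci ct cu] := out1 _ cs; rewrite f3r// f2r// f1r//.
  by apply: fa1; rewrite mem_cat cs.
have js1 : j \notin s1 by apply/negP => /out1[]; rewrite eqxx.
have [||b [b' hb]] : affine_fun (f4 j i) := fin mu4 f4 w4 s1 (u ++ v) w40 _ _.
- apply: perm_trans ps; apply: perm_trans p3.
  by rewrite -[t :: s1 ++ _]cat1s -[t :: j :: _]cat1s perm_catCA.
- by move=> x; rewrite q4 q3; have := q2 x; rewrite !cat_rcons => ->; have := q1 x; rewrite -!catA.
(* Passing [j] added [a3] times [f2 t i] to [f j i], and [f2 t i] is affine because the swap with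
   [i] has just created it. *)
have [c [c' hc]] := f2t.
exists (b - a3 * c), (b' - a3 * c') => y.
have -> : f j i y = f4 j i y - a3 * f2 t i y by rewrite f4r// f3j f2r// f1r// addrK.
by rewrite hb hc; ring.
Qed.
End Qform.

(** * Conditioning on sigma-algebras generated by coordinates *)

Lemma integral_mrestr d (T : measurableType d) (R : realType) (mu : {measure set T -> \bar R})
    (G : set T) (mG : measurable G) (f : T -> \bar R) :
  measurable_fun setT f -> (forall x, 0 <= f x)%E ->
  (\int[mrestr mu mG]_x f x = \int[mu]_(x in G) f x)%E.
Proof.
move=> mf f0; have mGC : measurable (~` G) by exact: measurableC.
rewrite (@ge0_negligible_integral _ _ _ _ setT (~` G))//; last first.
  by rewrite /= /mrestr setICl measure0.
rewrite setTD setCK; apply: eq_measure_integral => A mA AG.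
by rewrite /= /mrestr setIidl.
Qed.

(** Under [P] restricted to [G], the law of [(M, E)] agrees on rectangles with the product of the
    law of [M] and [nu], hence is this product; its value on [W] is then an integral over
    sections. *)
Lemma independent_disintegration d (Omega : measurableType d) d1 (T : measurableType d1) d2 (T2 : measurableType d2)
    (R : realType) (P : probability Omega R) (nu : probability T2 R)
    (G : set Omega) (mG : measurable G) (M : Omega -> T) (E : Omega -> T2) :
    measurable_fun setT M -> measurable_fun setT E ->
    (forall A B, measurable A -> measurable B ->
      P (G `&` M @^-1` A `&` E @^-1` B) = P (G `&` M @^-1` A) * nu B)%E ->
  forall W : set (T * T2), measurable W ->
    (P (G `&` [set w | W (M w, E w)]) = \int[P]_(w in G) nu (xsection W (M w)))%E.
Proof.
move=> mM mE H W mW.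
pose PG := mrestr P mG.
pose m1 := pushforward PG M.
have m1fin : fin_num_fun m1.
  move=> A mA; rewrite /m1 /pushforward /PG /mrestr fin_num_measure//.
  by apply: measurableI => //; rewrite -[_ @^-1` _]setTI; exact: mM.
pose m1mix := Measure_isFinite.Build _ _ _ m1 m1fin.
pose m1'' : {finite_measure set T -> \bar R} := HB.pack m1 (m1mix mM).
pose m1' := m1'' mM.
have mME : measurable_fun setT (fun w => (M w, E w)) by exact: measurable_fun_pair.
pose m'' : {measure set (T * T2) -> \bar R} := pushforward PG (fun w => (M w, E w)).
pose m' := m'' mME.
have eqp A B : measurable A -> measurable B -> m' (A `*` B) = (m1' A * nu B)%E.
  move=> mA mB; have := H _ _ mA mB.
  rewrite /m' /m1' /m'' /m1'' /= /pushforward /m1 /pushforward /PG /mrestr [_ @^-1` A `&` G]setIC => <-.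
  by congr (P _); apply/seteqP; split => w /=; tauto.
have := product_measure_unique eqp mW.
rewrite [RHS](_ : _ = P (G `&` [set w | W (M w, E w)])); last by rewrite /m' /m'' /= /pushforward /PG /mrestr setIC.
move=> <-; rewrite /product_measure1 /=.
have mx : measurable_fun setT (nu \o xsection W) by exact: measurable_fun_xsection.
rewrite ge0_integral_pushforward// preimage_setT integral_mrestr//.
exact: measurableT_comp.
Qed.

Section SigmaX.
Context (R : realType) (d : measure_display) (Omega : measurableType d)
        (P : probability Omega R) (p : nat).
Implicit Types (Y : 'I_p -> Omega -> R) (S U : {set 'I_p}).

Lemma sigmaX_sigma_algebra Y S : sigma_algebra setT (sigmaX Y S).
Proof. exact: smallest_sigma_algebra. Qed.

Lemma sigmaX_preimage Y S s (B : set R) : s \in S -> measurable B -> sigmaX Y S (Y s @^-1` B).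
Proof. by move=> sS mB; apply: sub_sigma_algebra; exists s, B. Qed.

Lemma sigmaX_measurable Y S E : (forall s, s \in S -> measurable_fun setT (Y s)) ->
  sigmaX Y S E -> measurable E.
Proof.
move=> mY; apply: (smallest_sub (@sigma_algebra_measurable _ Omega)) => _ [s [B [sS mB ->]]].
by rewrite -[_ @^-1` _]setTI; exact: mY.
Qed.

Lemma sigmaX_sub Y S F : sigma_algebra setT F ->
  (forall s B, s \in S -> measurable B -> F (Y s @^-1` B)) -> sigmaX Y S `<=` F.
Proof. by move=> sF h; apply: smallest_sub => // _ [s [B [sS mB ->]]]; exact: h. Qed.

Lemma sigmaX_mono Y S U : S \subset U -> sigmaX Y S `<=` sigmaX Y U.
Proof.
move=> SU; apply: sigmaX_sub; first exact: sigmaX_sigma_algebra.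
by move=> s B sS mB; apply: sigmaX_preimage => //; exact: (fintype.subsetP SU).
Qed.

(* [sigma_type Y S] carries the sigma-algebra [sigmaX Y S], so that measurability with respect to it is [measurable_fun]. *)
Definition sigma_type Y S :=
  g_sigma_algebraType [set E : set Omega | exists s B, [/\ s \in S, measurable B & E = Y s @^-1` B]].
HB.instance Definition _ Y S := Measurable.on (sigma_type Y S).

Lemma measurable_sigma_type Y S (f : Omega -> R) : measurable_fun setT (f : sigma_type Y S -> R) <->
  forall B : set R, measurable B -> sigmaX Y S (f @^-1` B).
Proof.
split=> [mf B mB|h _ B mB]; last by rewrite setTI; exact: h.
by rewrite -[_ @^-1` _]setTI; exact: mf.
Qed.

(** Both sides are finite measures in [E]. They agree on cylinders constraining only coordinates in
    [U], which are stable under intersection and generate [sigmaX Y U]. *)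
Lemma mutually_independent_sigmaX Y U v E B : (forall s, measurable_fun setT (Y s)) ->
  mutually_independent P Y -> v \notin U -> sigmaX Y U E -> measurable B ->
  (P (E `&` Y v @^-1` B) = P E * P (Y v @^-1` B))%E.
Proof.
move=> mY indep vU sE mB.
have mpre s A : measurable A -> measurable (Y s @^-1` A).
  by move=> mA; rewrite -[_ @^-1` _]setTI; exact: mY.
have mvB := mpre v B mB.
pose m1 : {measure set Omega -> \bar R} := mrestr P mvB.
have fP := fin_num_measure P _ mvB.
have r0 : 0 <= fine (P (Y v @^-1` B)) by exact: fine_ge0.
pose m2 : {measure set Omega -> \bar R} := mscale (NngNum r0) P.
pose Gs := [set A : set Omega | exists C : 'I_p -> set R, [/\ forall l, measurable (C l),
   forall l, l \notin U -> C l = setT & A = \bigcap_(l in [set: 'I_p]) (Y l @^-1` C l)]].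
suff : m1 E = m2 E by rewrite /m1 /m2 /= /mrestr /mscale /= fineK// => ->; rewrite muleC.
apply: (@g_sigma_algebra_measure_unique _ _ _ Gs _ (fun=> setT)).
- move=> _ [C [mC _ ->]]; apply: fin_bigcap_measurable => // l _; exact: mpre.
- move=> _; exists (fun=> setT); split => //; apply/seteqP; split => //.
- by rewrite bigcup_const.
- move=> _ _ [C1 [mC1 C1U ->]] [C2 [mC2 C2U ->]]; exists (fun l => C1 l `&` C2 l); split.
  + by move=> l; exact: measurableI.
  + by move=> l lU; rewrite C1U// C2U// setTI.
  + by rewrite -bigcapI.
- move=> _ [C [mC CU ->]].
  rewrite /m1 /m2 /= /mrestr /mscale /= fineK//.
  (* As [v] is outside [U], the cylinder has the full line at [v], and this slot can receive [B]. *)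
  pose C' l := if l == v then B else C l.
  have mC' l : measurable (C' l) by rewrite /C'; case: ifP.
  have -> : \bigcap_(l in [set: 'I_p]) (Y l @^-1` C l) `&` Y v @^-1` B =
      \bigcap_(l in [set: 'I_p]) (Y l @^-1` C' l).
    apply/seteqP; split => [w [hw hv] l _|w hw].
      by rewrite /C' /preimage /=; case: eqP => [->//|_]; exact: hw.
    split; last by have := hw v I; rewrite /C' eqxx.
    move=> l _; have := hw l I; rewrite /C'; case: eqP => // -> _.
    by rewrite CU.
  rewrite indep// indep// (bigD1 v)//= [in RHS](bigD1 v)//= /C' eqxx CU// preimage_setT probability_setT mul1e.
  by congr (_ * _)%E; apply: eq_bigr => l lv; rewrite (negPf lv).
- by move=> _; rewrite /m1 /= /mrestr setTI ltey_eq fP.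
- apply: sigmaX_sub sE; first exact: smallest_sigma_algebra.
  move=> s A sU mA; apply: sub_sigma_algebra.
  exists (fun l => if l == s then A else setT); split.
  + by move=> l; case: ifP.
  + by move=> l; case: eqP => // -> ; rewrite sU.
  + apply/seteqP; split => [w hw l _|w /(_ s I)]; last by rewrite eqxx.
    by rewrite /preimage /=; case: eqP => // ->.
Qed.
End SigmaX.

(** * Gaussian additive models *)

Lemma measurable_preimage d1 d2 (T1 : measurableType d1) (T2 : measurableType d2) (f : T1 -> T2) B :
  measurable_fun setT f -> measurable B -> measurable (f @^-1` B).
Proof. by move=> mf mB; rewrite -[_ @^-1` _]setTI; exact: mf. Qed.

Lemma integral_between d (T : measurableType d) (R : realType) (mu : {measure set T -> \bar R})
    (D : set T) (f : T -> \bar R) (m a b : R) :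
  measurable D -> mu D = m%:E -> measurable_fun D f -> (forall x, D x -> 0 <= f x)%E ->
  (forall x, D x -> a%:E <= f x <= b%:E)%E ->
  ((a * m)%:E <= \int[mu]_(x in D) f x <= (b * m)%:E)%E.
Proof.
move=> mD muD mf f0 fab.
have m0 : 0 <= m by rewrite -lee_fin -muD measure_ge0.
have If0 : (0 <= \int[mu]_(x in D) f x)%E by exact: integral_ge0.
apply/andP; split.
  (* The lower constant will be a density value minus an error and may be negative; nonnegativity of
     the integral then settles the bound. *)
  have [a0|a0] := leP a 0.
    by apply: le_trans If0; rewrite lee_fin mulr_le0_ge0.
  rewrite EFinM -muD -integral_cst//; apply: ge0_le_integral => //.
  - by move=> x _; rewrite lee_fin ltW.
  - by move=> x /fab/andP[].
have [D0|D0] := eqVneq D set0.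
  move: muD; rewrite D0 measure0 => -[<-].
  by rewrite integral_set0 mulr0.
have /set0P[x0 Dx0] := D0.
have b0 : 0 <= b.
  by have /andP[_] := fab _ Dx0; rewrite -lee_fin; apply: le_trans; exact: f0.
rewrite EFinM -muD -integral_cst//; apply: ge0_le_integral => //.
by move=> x /fab/andP[].
Qed.

Lemma normal_prob_small_interval (R : realType) (sigma r e : R) : 0 < sigma -> 0 < e ->
  exists2 dl, 0 < dl & forall a h, 0 < h < dl -> `|a - r| < dl ->
    (((normal_pdf 0 sigma r - e) * h)%:E <= normal_prob 0 sigma `[a, (a + h)%R] <=
     ((normal_pdf 0 sigma r + e) * h)%:E)%E.
Proof.
move=> s0 e0.
have := @continuous_normal_pdf R 0 sigma (lt0r_neq0 s0) r.
move/cvgrPdist_le => /(_ _ e0)[/= dl dl0 Hd].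
(* Half for the distance from [a] to [r] and half for the length [h] keep the whole interval within
   [dl] of [r]. *)
exists (dl / 2) => [|a h /andP[h0 hd] ad]; first by rewrite divr_gt0.
apply: integral_between => //.
- by rewrite [LHS]lebesgue_measure_itv /= lte_fin ltrDl h0 -EFinB addrC addKr.
- by apply/measurable_EFinP; apply: measurable_funTS; exact: measurable_normal_pdf.
- by move=> x _; rewrite lee_fin normal_pdf_ge0.
move=> x; rewrite /= in_itv /= => /andP[ax xah]; rewrite !lee_fin.
have := Hd x; rewrite /ball_ /= => /(_ _)/wrap[].
  by move: ad; rewrite ltr_norml ltr_norml => /andP[? ?]; apply/andP; split; lra.
by rewrite ler_norml => /andP[? ?]; apply/andP; split; lra.
Qed.

Lemma measurable_shifted_set (R : realType) (A : set R) : measurable A ->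
  measurable [set z : R * R | A (z.1 + z.2)].
Proof.
move=> mA; apply: (measurable_preimage (f := fun z : R * R => z.1 + z.2)) => //.
exact: measurable_funD.
Qed.

Lemma measurable_shifted_prob (R : realType) (nu : probability (measurableTypeR R) R) (A : set R) : measurable A ->
  measurable_fun setT (fun m : R => nu [set e : R | A (m + e)]).
Proof.
move=> mA; rewrite (_ : (fun m => _) = nu \o xsection [set z : R * R | A (z.1 + z.2)]).
  by apply: measurable_fun_xsection; exact: measurable_shifted_set.
by apply/funext => m /=; rewrite xsectionE.
Qed.

Section Sem.
Context (R : realType) (d : measure_display) (Omega : measurableType d)
        (P : probability Omega R) (p : nat) (X : 'I_p -> Omega -> R).
Hypothesis mX : forall i, measurable_fun setT (X i).
Variables (D : dag p) (mu : 'I_p -> R) (f : 'I_p -> 'I_p -> R -> R) (sigma : 'I_p -> R).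

Definition regression j w := mu j + \sum_(i in parents D j) f j i (X i w).
Definition residual j w := X j w - mu j - \sum_(i in parents D j) f j i (X i w).

(** Separated from [PLSEM_generates] so that a reversed system can be handled at this level before
    its edge functions are known to be centered and nonzero. *)
Definition gaussian_sem := [/\ forall j, 0 < sigma j,
  forall i j, (i, j) \in D -> continuous (f j i),
  mutually_independent P residual &
  forall j (B : set R), measurable B -> P (residual j @^-1` B) = normal_prob 0 (sigma j) B].

Hypotheses (dD : is_dag D) (sem : gaussian_sem).

Lemma regression_residual j w : X j w = regression j w + residual j w.
Proof. by rewrite /regression /residual; ring. Qed.

Lemma measurable_regression d' (T : measurableType d') (Y : 'I_p -> T -> R) j :
  (forall i, (i, j) \in D -> measurable_fun setT (Y i)) ->
  measurable_fun setT (fun w => mu j + \sum_(i in parents D j) f j i (Y i w)).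
Proof.
move=> mY; have [_ cf _ _] := sem.
apply: measurable_funD => //.
rewrite (_ : (fun w => _) = (fun w => \sum_(i < p) if i \in parents D j then f j i (Y i w) else 0)); last first.
  by apply/funext => w; rewrite big_mkcond.
apply: measurable_sum => i; case: (boolP (i \in parents D j)) => //; rewrite mem_parents => iD.
apply: measurableT_comp; last exact: mY.
by apply: continuous_measurable_fun; exact: cf.
Qed.

Lemma measurable_residual j : measurable_fun setT (residual j).
Proof.
rewrite (_ : residual j = (fun w => X j w - regression j w)); last first.
  by apply/funext => w; rewrite regression_residual [RHS]addrC addKr.
by apply: measurable_funB => //; apply: measurable_regression => i _; exact: mX.
Qed.

Definition parent_closed (U : {set 'I_p}) := forall u v, v \in U -> (u, v) \in D -> u \in U.

(** The recursive system is solved by induction on the rank: inside a parent-closed set the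
    coordinates are measurable functions of the residuals. *)
Lemma measurable_residuals U : parent_closed U ->
  forall v, v \in U -> measurable_fun setT (X v : sigma_type residual U -> R).
Proof.
move=> cU v; have [n] := ubnP (rank D v); elim: n v => // n IH v rv vU.
rewrite (_ : X v = (fun w => regression v w + residual v w)); last first.
  by apply/funext => w; exact: regression_residual.
apply: measurable_funD; last first.
  by apply/measurable_sigma_type => B mB; exact: sigmaX_preimage.
apply: (@measurable_regression _ (sigma_type residual U) X) => i iv.
apply: IH; last exact: cU vU iv.
exact: leq_trans (rank_lt dD iv) _.
Qed.

Lemma residual_independent (U : {set 'I_p}) v E B : parent_closed U -> v \notin U -> sigmaX X U E ->
  measurable B -> (P (E `&` residual v @^-1` B) = P E * normal_prob 0 (sigma v) B)%E.
Proof.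
move=> cU vU sE mB; have [_ _ indep lawE] := sem; rewrite -lawE//.
apply: (mutually_independent_sigmaX (U := U)) => //; first exact: measurable_residual.
apply: sigmaX_sub sE; first exact: sigmaX_sigma_algebra.
by move=> s A sU mA; have /measurable_sigma_type := measurable_residuals cU sU; exact.
Qed.

Lemma sigma_measurable_regression (U : {set 'I_p}) v : (forall u, (u, v) \in D -> u \in U) ->
  measurable_fun setT (regression v : sigma_type X U -> R).
Proof.
move=> pU; apply: (@measurable_regression _ (sigma_type X U) X) => i iv.
by apply/measurable_sigma_type => B mB; apply: sigmaX_preimage => //; exact: pU.
Qed.

(** Given the coordinates in [U], the regression at [v] is known and the noise of [v] is still a
    fresh normal variable, since [U] contains no descendant of [v]. *)
Lemma sem_disintegration (U : {set 'I_p}) v G A : parent_closed U -> v \notin U -> (forall u, (u, v) \in D -> u \in U) ->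
  sigmaX X U G -> measurable A ->
  (P (G `&` X v @^-1` A) = \int[P]_(w in G) normal_prob 0 (sigma v) [set e | A (regression v w + e)%R])%E.
Proof.
move=> cU vU pU sG mA.
have mG : measurable G by apply: sigmaX_measurable sG.
have mM := sigma_measurable_regression pU.
pose W := [set z : R * R | A (z.1 + z.2)].
have mW : measurable W by exact: measurable_shifted_set.
have mM' : measurable_fun setT (regression v).
  by apply: measurable_regression => i _; exact: mX.
have H B C : measurable B -> measurable C ->
    (P (G `&` regression v @^-1` B `&` residual v @^-1` C) =
     P (G `&` regression v @^-1` B) * normal_prob 0 (sigma v) C)%E.
  move=> mB mC; apply: residual_independent (cU) (vU) _ mC.
  have sB := (measurable_sigma_type _ _ _).1 mM B mB.
  exact: (@measurableI _ (sigma_type X U) _ _ sG sB).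
have := @independent_disintegration _ _ _ _ _ _ _ P (normal_prob 0 (sigma v)) _ mG _ _ mM' (measurable_residual v) H W mW.
rewrite (_ : [set w | W _] = X v @^-1` A); last first.
  by apply/seteqP; split => w; rewrite /W /= -regression_residual.
by move=> ->; apply: eq_integral => w _; rewrite xsectionE.
Qed.
End Sem.

(** * The joint density *)

Lemma sum_continuous_near (R : realType) (T : eqType) (g : T -> R -> R) (x : T -> R) (l : seq T) e :
  (forall i, i \in l -> {for x i, continuous (g i)}) -> 0 < e ->
  \forall h \near 0^'+, forall y : T -> R, (forall i, i \in l -> x i <= y i <= x i + h) ->
    `|\sum_(i <- l) g i (y i) - \sum_(i <- l) g i (x i)| < e.
Proof.
elim: l e => [|a l IH] e cg e0.
  by near=> h => y _; rewrite !big_nil subrr normr0.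
have e2 : 0 < e / 2 by rewrite divr_gt0.
have cl i : i \in l -> {for x i, continuous (g i)} by move=> il; apply: cg; rewrite inE il orbT.
have /cvgrPdist_lt/(_ _ e2)[/= dl dl0 Hd] := cg a (mem_head a l).
have near_l := IH _ cl e2.
near=> h.
have hl : forall y : T -> R, (forall i, i \in l -> x i <= y i <= x i + h) ->
    `|\sum_(i <- l) g i (y i) - \sum_(i <- l) g i (x i)| < e / 2 by near: h.
have hd : h < dl by near: h; exact: nbhs_right_lt.
move=> y Hy; rewrite !big_cons opprD addrACA.
rewrite (splitr e) (le_lt_trans (ler_normD _ _))// ltrD//; last first.
  by apply: hl => i il; apply: Hy; rewrite inE il orbT.
rewrite distrC; apply: Hd; rewrite /ball_ /=.
have /andP[y1 y2] := Hy a (mem_head a l).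
by rewrite ltr_norml; apply/andP; split; lra.
Unshelve. all: by end_near. Qed.

Section Box.
Context (R : realType) (d : measure_display) (Omega : measurableType d)
        (P : probability Omega R) (p : nat) (X : 'I_p -> Omega -> R).
Hypothesis mX : forall i, measurable_fun setT (X i).

Definition box (x : 'I_p -> R) (h : R) (s : seq 'I_p) : set Omega :=
  [set w | forall k, k \in s -> X k w \in `[x k, x k + h]].

Lemma box_cons x h v s : box x h (v :: s) = box x h s `&` X v @^-1` `[x v, x v + h].
Proof.
apply/seteqP; split => w.
  move=> hw; split; last exact: hw (mem_head _ _).
  by move=> k ks; apply: hw; rewrite inE ks orbT.
by move=> [hw hv] k; rewrite inE => /orP[/eqP->//|]; exact: hw.
Qed.

Lemma sigmaX_box x h s (U : {set 'I_p}) : {subset s <= U} -> sigmaX X U (box x h s).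
Proof.
elim: s => [|v s IH] sU.
  rewrite (_ : box _ _ _ = setT); first exact: (@measurableT _ (sigma_type X U)).
  by apply/seteqP; split.
rewrite box_cons; apply: (@measurableI _ (sigma_type X U)).
  by apply: IH => k ks; apply: sU; rewrite inE ks orbT.
by apply: sigmaX_preimage => //; apply: sU; exact: mem_head.
Qed.

Section Density.
Variables (D : dag p) (mu : 'I_p -> R) (f : 'I_p -> 'I_p -> R -> R) (sigma : 'I_p -> R).
Hypotheses (dD : is_dag D) (sem : gaussian_sem P X D mu f sigma).

Definition mean_at (x : 'I_p -> R) v := mu v + \sum_(i in parents D v) f v i (x i).

Definition sem_density (s : seq 'I_p) (x : 'I_p -> R) :=
  \prod_(v <- s) normal_pdf 0 (sigma v) (x v - mean_at x v).

Lemma mean_at_near x v e : 0 < e -> \forall h \near 0^'+, forall w,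
  (forall i, (i, v) \in D -> x i <= X i w <= x i + h) -> `|regression X D mu f v w - mean_at x v| < e.
Proof.
move=> e0; have [_ cf _ _] := sem.
have cf' i : i \in enum (parents D v) -> {for x i, continuous (f v i)}.
  by rewrite mem_enum mem_parents => /cf; exact.
have H := sum_continuous_near cf' e0.
near=> h => w Hw.
rewrite /regression /mean_at opprD addrACA subrr add0r -!big_enum.
have Hh : forall y : 'I_p -> R, (forall i, i \in enum (parents D v) -> x i <= y i <= x i + h) ->
   `|\sum_(i <- enum (parents D v)) f v i (y i) - \sum_(i <- enum (parents D v)) f v i (x i)| < e.
  by near: h.
by apply: (Hh (X^~ w)) => i; rewrite mem_enum mem_parents; exact: Hw.
Unshelve. all: by end_near. Qed.

(** A topological order of an ancestor-closed set of vertices. Unlike [topological], it passes to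
    tails, which the induction over coordinates requires. *)
Definition ancestral (s : seq 'I_p) :=
  forall s1 v s2, s = s1 ++ v :: s2 -> forall u, (u, v) \in D -> u \in s2.

Lemma ancestral_behead v s : ancestral (v :: s) -> ancestral s.
Proof. by move=> h s1 u s2 E; apply: (h (v :: s1)); rewrite E. Qed.

Lemma ancestral_closed s : ancestral s -> parent_closed D [set k in s].
Proof.
move=> h u v; rewrite !inE => vs; case/path.splitPr: vs h => s1 s2 h uv.
by rewrite mem_cat inE (h _ _ _ erefl _ uv) !orbT.
Qed.

(** On the box of the preceding coordinates the parents of [v] are within [h] of [x], so the
    regression is uniformly close to [mean_at x v], and the conditional probability of the interval
    is close to [h] times one density value. *)
Lemma box_prob_step x v s e : uniq (v :: s) -> ancestral (v :: s) -> 0 < e ->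
  \forall h \near 0^'+,
   ((normal_pdf 0 (sigma v) (x v - mean_at x v) - e) * h * fine (P (box x h s)) <=
     fine (P (box x h (v :: s))) <=
    (normal_pdf 0 (sigma v) (x v - mean_at x v) + e) * h * fine (P (box x h s))).
Proof.
move=> /= /andP[vs us] anc e0; have [s0 cf _ _] := sem.
set r := x v - mean_at x v.
have [dl dl0 Hdl] := normal_prob_small_interval r (s0 v) e0.
have Hn := mean_at_near x v dl0.
have pS u : (u, v) \in D -> u \in [set k in s] by rewrite inE; exact: (anc [::]).
near=> h.
have h0 : 0 < h by near: h; exact: nbhs_right_gt.
have hd : h < dl by near: h; exact: nbhs_right_lt.
have Hh : forall w, (forall i, (i, v) \in D -> x i <= X i w <= x i + h) ->
   `|regression X D mu f v w - mean_at x v| < dl by near: h.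
have sB : sigmaX X [set k in s] (box x h s) by apply: sigmaX_box => k; rewrite inE.
have mB : measurable (box x h s) by apply: sigmaX_measurable sB.
have vU : v \notin [set k in s] by rewrite inE.
have := sem_disintegration mX dD sem (ancestral_closed (ancestral_behead anc)) vU pS sB
  (measurable_itv `[x v, x v + h]).
rewrite -box_cons => E.
have mB' : measurable (box x h (v :: s)).
  by apply: (@sigmaX_measurable _ _ _ _ X finset.setT) => //; apply: sigmaX_box => k; rewrite inE.
have fB : P (box x h s) = (fine (P (box x h s)))%:E by rewrite fineK// fin_num_measure.
have fB' : P (box x h (v :: s)) = (fine (P (box x h (v :: s))))%:E by rewrite fineK// fin_num_measure.
rewrite -!lee_fin -fB' E; apply: integral_between => //.
- have mI : measurable (`[x v, x v + h]%classic : set R) by exact: measurable_itv.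
  have mk := @measurable_shifted_prob R (normal_prob 0 (sigma v)) _ mI.
  apply: measurable_funTS; apply: (measurableT_comp mk).
  by apply: (measurable_regression sem) => i _; exact: mX.
- move=> w hw.
  rewrite (_ : [set e0 | _] = `[x v - regression X D mu f v w, x v - regression X D mu f v w + h]%classic); last first.
    by apply/seteqP; split => z /=; rewrite !in_itv /= => /andP[? ?]; apply/andP; split; lra.
  apply: Hdl; first by rewrite h0.
  rewrite (_ : _ - r = - (regression X D mu f v w - mean_at x v)); last by rewrite /r; ring.
  rewrite normrN; apply: Hh => i iv; have := hw i.
  by rewrite in_itv; apply; exact: (anc [::]).
Unshelve. all: by end_near. Qed.

Lemma box_density x s : uniq s -> ancestral s ->
  fine (P (box x h s)) / h ^+ size s @[h --> 0^'+] --> sem_density s x.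
Proof.
elim: s => [_ _|v s IH uvs anc].
  rewrite /sem_density big_nil.
  apply: cvg_near_cst; near=> h; rewrite expr0 divr1.
  rewrite (_ : box _ _ _ = setT) ?probability_setT//.
  by apply/seteqP; split.
have {}IH := IH (andP uvs).2 (ancestral_behead anc).
rewrite /sem_density big_cons -/(sem_density s x); set phi := normal_pdf _ _ _.
pose q h := fine (P (box x h s)) / h ^+ size s.
pose r h := fine (P (box x h (v :: s))) / h ^+ (size s).+1.
have -> : (fun h => fine (P (box x h (v :: s))) / h ^+ size (v :: s)) = (fun h => phi * q h + (r h - phi * q h)).
  by apply/funext => h; rewrite addrC subrK.
rewrite -[X in _ --> X]addr0; apply: cvgD.
  by apply: cvgM => //; exact: cvg_cst.
(* [L] bounds the convergent quotient [q] near zero, so a one-step error of [e / L] contributes at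
   most [e]. *)
apply/cvgrPdist_le => e e0; pose L := `|sem_density s x| + 1.
have L0 : 0 < L by rewrite /L ltr_pwDr.
have eL : 0 < e / L by rewrite divr_gt0.
have step := box_prob_step x uvs anc eL.
have qL : \forall h \near 0^'+, `|q h| <= L.
  have /cvgrPdist_le/(_ _ ltr01) := IH; apply: filterS => h hq.
  rewrite /L -[q h](subrK (sem_density s x)) addrC.
  by apply: le_trans (ler_normD _ _) _; rewrite lerD2l distrC.
near=> h.
have h0 : 0 < h by near: h; exact: nbhs_right_gt.
have hqL : `|q h| <= L by near: h.
have /andP[s1 s2] : ((phi - e / L) * h * fine (P (box x h s)) <= fine (P (box x h (v :: s))) <=
    (phi + e / L) * h * fine (P (box x h s))) by near: h.
have hn : 0 < h ^+ (size s).+1 by exact: exprn_gt0.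
have hq c : c * q h = (c * h * fine (P (box x h s))) / h ^+ (size s).+1.
  rewrite /q exprS; field.
  by rewrite expf_neq0// ?gt_eqF.
rewrite sub0r normrN.
have h1 : (phi - e / L) * q h <= r h by rewrite hq /r ler_pM2r ?invr_gt0.
have h2 : r h <= (phi + e / L) * q h by rewrite hq /r ler_pM2r ?invr_gt0.
have h3 : e / L * q h <= e.
  rewrite mulrAC ler_pdivrMr// ler_wpM2l ?(ltW e0)//.
  by apply: le_trans hqL; exact: ler_norm.
move: h1 h2; rewrite mulrBl mulrDl => h1 h2.
by rewrite ler_norml; apply/andP; split; lra.
Unshelve. all: by end_near. Qed.

Lemma sem_density_gt0 s x : 0 < sem_density s x.
Proof.
have [s0 _ _ _] := sem.
by apply: prodr_gt0 => v _; rewrite normal_pdfE ?gt_eqF// mulr_gt0 ?expR_gt0// normal_peak_gt0 ?gt_eqF.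
Qed.

(** [K] collects the logarithms of the normal peaks, and the weights are [1 / (2 sigma^2)]. As
    [qform] sums over all predecessors, those that are not parents receive the zero function. *)
Lemma sem_density_qform : exists K, forall s x, uniq s -> ancestral s ->
  - ln (sem_density s x) = qform mu (fun v i y => if (i, v) \in D then f v i y else 0)
      (fun v => (sigma v ^+ 2 *+ 2)^-1) s x + \sum_(v <- s) K v.
Proof.
have [s0 _ _ _] := sem.
exists (fun v => - ln (normal_peak (sigma v))) => s x; elim: s => [|v s IH].
  by rewrite /sem_density !big_nil ln1 oppr0 addr0.
move=> uvs anc; have us : uniq s by case/andP: uvs.
rewrite /sem_density !big_cons lnM; last 2 first.
- by rewrite posrE normal_pdfE ?gt_eqF// mulr_gt0 ?expR_gt0// normal_peak_gt0 ?gt_eqF.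
- by rewrite posrE sem_density_gt0.
rewrite opprD IH//; last exact: ancestral_behead anc.
rewrite normal_pdfE ?gt_eqF// lnM ?posrE ?expR_gt0 ?normal_peak_gt0 ?gt_eqF//.
rewrite /normal_fun expRK subr0 opprD mulNr opprK /=.
have -> : \sum_(k <- s) (if (k, v) \in D then f v k (x k) else 0) = \sum_(i in parents D v) f v i (x i).
  rewrite -big_mkcond -big_filter -[RHS]big_enum; apply: perm_big.
  apply: uniq_perm => [||k]; [exact: filter_uniq|exact: enum_uniq|].
  rewrite mem_filter mem_enum mem_parents; case: (boolP ((k, v) \in D)) => //= kv.
  by rewrite (anc [::] v s erefl).
rewrite /mean_at opprD addrA; ring.
Qed.
End Density.

Lemma sem_qform_eq D mu f sigma D' mu' f' sigma' s s' :
    is_dag D -> gaussian_sem P X D mu f sigma -> topological D s ->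
    is_dag D' -> gaussian_sem P X D' mu' f' sigma' -> topological D' s' ->
  exists K, forall x,
    qform mu (fun v i y => if (i, v) \in D then f v i y else 0) (fun v => (sigma v ^+ 2 *+ 2)^-1) s x =
    qform mu' (fun v i y => if (i, v) \in D' then f' v i y else 0) (fun v => (sigma' v ^+ 2 *+ 2)^-1) s' x + K.
Proof.
move=> dD sem ts dD' sem' ts'.
have anc E t : is_dag E -> topological E t -> ancestral E t.
  by move=> dE + s1 v s2 E1; rewrite E1 => tt u uv; exact: topological_parents dE tt uv.
have us : uniq s by case: ts. have us' : uniq s' by case: ts'.
have pss' : perm_eq s s'.
  by apply: uniq_perm => // v; case: ts => _ -> _; case: ts' => _ -> _.
have [K HK] := sem_density_qform sem; have [K' HK'] := sem_density_qform sem'.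
exists (\sum_(v <- s') K' v - \sum_(v <- s) K v) => x.
have c1 := box_density dD sem (x := x) us (anc _ _ dD ts).
have c2 := box_density dD' sem' (x := x) us' (anc _ _ dD' ts').
have E : sem_density D mu f sigma s x = sem_density D' mu' f' sigma' s' x.
  (* The box depends only on the set of coordinates, so the two orders give the same quotient and
     hence the same limit. *)
  have Eq : (fun h => fine (P (box x h s)) / h ^+ size s) = (fun h => fine (P (box x h s')) / h ^+ size s').
    apply/funext => h; rewrite (perm_size pss'); congr (fine (P _) / _); apply/seteqP.
    by split => w hw k ks; apply: hw; rewrite ?(perm_mem pss')// -(perm_mem pss').
  by rewrite Eq in c1; exact: norm_cvg_unique c1 c2.
have := HK _ x us (anc _ _ dD ts); have := HK' _ x us' (anc _ _ dD' ts').
rewrite E => -> /esym/eqP; rewrite -subr_eq => /eqP <-; ring.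
Qed.

Lemma sem_reversed_affine D mu f sigma D' mu' f' sigma' i j :
    is_dag D -> gaussian_sem P X D mu f sigma ->
    is_dag D' -> gaussian_sem P X D' mu' f' sigma' ->
    covered D i j -> (j, i) \in D' ->
  affine_fun (f j i).
Proof.
move=> dD sem dD' sem' cv ji'.
have [s1 [s2 ts]] := topological_covered dD cv; have ts' := by_rank_topological dD'.
have [K HK] := sem_qform_eq dD sem ts dD' sem' ts'.
have ij : (i, j) \in D by case: cv.
have := qform_reversed_affine (R := R) (i := i) (j := j) _ _ _ _ HK.
rewrite ij; apply.
- by case: ts'.
- by apply: uniq_perm => [||v]; [case: ts|case: ts'|case: ts => _ -> _; case: ts' => _ -> _].
- by move=> r; case: sem => s0 _ _ _; rewrite invr_gt0 mulrn_wgt0// exprn_gt0.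
- by move=> r; case: sem' => s0 _ _ _; rewrite invr_gt0 mulrn_wgt0// exprn_gt0.
- exact: topological_index ji'.
Qed.
End Box.

(** * Normal integrals and rotation of independent normals *)

Lemma integral_independent d (Omega : measurableType d) d1 (T : measurableType d1) (R : realType)
    (P : probability Omega R) (nu : probability T R) (G : set Omega) (mG : measurable G)
    (M : Omega -> T) (psi : T -> \bar R) :
    measurable_fun setT M -> measurable_fun setT psi -> (forall x, 0 <= psi x)%E ->
    (forall A, measurable A -> P (G `&` M @^-1` A) = P G * nu A)%E ->
  (\int[P]_(w in G) psi (M w) = P G * \int[nu]_x psi x)%E.
Proof.
move=> mM mpsi psi0 H.
have fG : P G = (fine (P G))%:E by rewrite fineK// fin_num_measure.
have r0 : 0 <= fine (P G) by exact: fine_ge0.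
rewrite -(integral_mrestr _ mG) //; last exact: measurableT_comp.
transitivity (\int[pushforward (mrestr P mG) M]_x psi x)%E.
  by rewrite ge0_integral_pushforward.
transitivity (\int[mscale (NngNum r0) nu]_x psi x)%E.
  apply: eq_measure_integral => A mA _.
  by rewrite /= /pushforward /mrestr /mscale /= -fG setIC; apply: H.
by rewrite ge0_integral_mscale// -fG.
Qed.

Section NormalIntegral.
Context (R : realType).
Local Notation leb := (@lebesgue_measure R).

Let integral_normal_bounded (s : R) (f : R -> R) : 0 < s -> measurable_fun setT f ->
  (exists M, forall x, `|f x| <= M) ->
  (\int[normal_prob 0 s]_x (f x)%:E = \int[leb]_x (f x * normal_pdf 0 s x)%:E)%E.
Proof.
move=> s0 mf [M fM].
have dom := normal_prob_dominates (0 : R) s.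
have mpdf := measurable_normal_pdf (0 : R) s.
rewrite -(Radon_Nikodym_change_of_variables dom)//=; last first.
  apply: measurable_bounded_integrable => //.
    by rewrite (le_lt_trans (probability_le1 _ _))// ltry.
  exists M; split; first exact: num_real.
  by move=> y My x _; exact: le_trans (fM x) (ltW My).
apply: ae_eq_integral => //.
- apply: emeasurable_funM; first exact/measurable_EFinP.
  by apply: (measurable_int leb); apply: Radon_Nikodym_integrable.
- by apply/measurable_EFinP; exact: measurable_funM.
under [X in ae_eq _ _ _ X]eq_fun do rewrite EFinM.
apply: ae_eqe_mul2l => /=.
rewrite Radon_NikodymE//=; case: cid => /= h [h1 h2 h3].
apply: integral_ae_eq => //=; first exact/measurable_EFinP.
by move=> E E01 mE; rewrite -h3.
Qed.

Import HBNNSimple.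

(** Simple functions are bounded, so the previous fact covers them, and monotone convergence on both
    sides extends it to nonnegative functions. *)
Lemma ge0_integral_normal (s : R) (f : R -> \bar R) : 0 < s -> measurable_fun setT f ->
  (forall x, 0 <= f x)%E ->
  (\int[normal_prob 0 s]_x f x = \int[leb]_x (f x * (normal_pdf 0 s x)%:E))%E.
Proof.
move=> s0 mf f0; pose f_ := nnsfun_approx measurableT mf.
have cf x : (f_ n x)%:E @[n --> \oo] --> f x by exact: cvg_nnsfun_approx.
have nd x : {homo (fun n => f_ n x) : n m / (n <= m)%N >-> n <= m}.
  by move=> n m nm; exact/lefP/nd_nnsfun_approx.
have mpdf := measurable_normal_pdf (0 : R) s.
have mf_ n : measurable_fun setT (f_ n) by exact: measurable_funP.
transitivity (limn (fun n => \int[normal_prob 0 s]_x (f_ n x)%:E)%E).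
  rewrite -monotone_convergence//.
  - by apply: eq_integral => x _; apply/esym/cvg_lim.
  - by move=> n; apply/measurable_EFinP; exact: mf_.
  - by move=> n x _; rewrite lee_fin.
  - by move=> x _ n m nm; rewrite lee_fin; exact: nd.
transitivity (limn (fun n => \int[leb]_x (f_ n x * normal_pdf 0 s x)%:E)%E).
  apply/congr_lim/funext => n; apply: integral_normal_bounded => //.
  have [M [_ HM]] := simple_bounded (f_ n).
  by exists (M + 1) => x; apply: HM => //; rewrite ltrDl.
rewrite -monotone_convergence//.
- apply: eq_integral => x _; apply/cvg_lim => //.
  under eq_fun do rewrite EFinM; apply: cvgeZr => //.
- by move=> n; apply/measurable_EFinP; exact: measurable_funM (mf_ n) mpdf.
- by move=> n x _; rewrite lee_fin mulr_ge0// normal_pdf_ge0.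
- by move=> x _ n m nm; rewrite lee_fin ler_wpM2r ?normal_pdf_ge0//; exact: nd.
Qed.

Lemma integral_shift (c : R) (g : R -> \bar R) : measurable_fun setT g -> (forall x, 0 <= g x)%E ->
  (\int[leb]_x g (x + c)%R = \int[leb]_x g x)%E.
Proof.
move=> mg g0.
have ms : measurable_fun setT ((fun x => x + c) : measurableTypeR R -> measurableTypeR R).
  exact: measurable_funD.
rewrite -[LHS](@ge0_integral_pushforward _ _ _ _ _ _ ms leb setT g)//.
apply: eq_measure_integral => A mA _; apply/esym.
apply: lebesgue_measure_unique mA => _ [[a b] _ <-] /=.
rewrite /pushforward /=.
rewrite (_ : _ @^-1` _ = `]a - c, b - c]%classic); last first.
  by apply/seteqP; split => x /=; rewrite !in_itv /= => /andP[? ?]; apply/andP; split; lra.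
rewrite !lebesgue_measure_itv /= !lte_fin ltrD2r; case: ifP => // _.
by rewrite -!EFinB; congr (_%:E); ring.
Qed.
End NormalIntegral.

Section Rotation.
Context (R : realType) (a s1 s2 : R).
Hypotheses (s10 : 0 < s1) (s20 : 0 < s2).
Local Notation leb := (@lebesgue_measure R).

(* For independent [x ~ N(0, s1^2)] and [y ~ N(0, s2^2)]: the standard deviation of [a x + y], that of the residual of [x] regressed on [a x + y], and the regression coefficient. *)
Definition rot_sd : R := Num.sqrt (a ^+ 2 * s1 ^+ 2 + s2 ^+ 2).
Definition rot_res_sd : R := s1 * s2 / rot_sd.
Definition rot_coef : R := a * s1 ^+ 2 / rot_sd ^+ 2.

Lemma rot_sd2 : rot_sd ^+ 2 = a ^+ 2 * s1 ^+ 2 + s2 ^+ 2.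
Proof. by rewrite sqr_sqrtr//; exact: addr_ge0 (mulr_ge0 (sqr_ge0 _) (sqr_ge0 _)) (sqr_ge0 _). Qed.

Lemma rot_sd_gt0 : 0 < rot_sd.
Proof. by rewrite sqrtr_gt0; exact: ltr_wpDl (mulr_ge0 (sqr_ge0 _) (sqr_ge0 _)) (exprn_gt0 _ s20). Qed.

Lemma rot_res_sd_gt0 : 0 < rot_res_sd.
Proof. by rewrite divr_gt0 ?mulr_gt0 ?rot_sd_gt0. Qed.

(** With [x = v + rot_coef * u] and [u = a * x + y], regression makes the cross term vanish. The
    peaks match because [rot_res_sd * rot_sd = s1 * s2], and the linear substitution has Jacobian of
    modulus one. *)
Lemma normal_pdf_rotation u v :
  normal_pdf 0 s1 (v + rot_coef * u) * normal_pdf 0 s2 (u - a * (v + rot_coef * u)) =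
  normal_pdf 0 rot_res_sd v * normal_pdf 0 rot_sd u.
Proof.
have S0 := rot_sd_gt0; have T0 := rot_res_sd_gt0.
rewrite !normal_pdfE ?gt_eqF// mulrACA [RHS]mulrACA; congr (_ * _).
  have pk r : 0 <= r ^+ 2 * pi *+ 2 :> R by rewrite mulrn_wge0// mulr_ge0 ?sqr_ge0 ?pi_ge0.
  rewrite /normal_peak -!invfM -(sqrtrM _ (pk s1)) -(sqrtrM _ (pk rot_res_sd)).
  congr ((Num.sqrt _)^-1); rewrite /rot_res_sd.
  rewrite !mulr2n; field; exact: lt0r_neq0.
rewrite /normal_fun -!expRD; congr expR; rewrite !subr0 /rot_res_sd /rot_coef.
rewrite !mulr2n expr_div_n rot_sd2.
have q0 : a ^+ 2 * s1 ^+ 2 + s2 ^+ 2 != 0 by rewrite -rot_sd2 expf_neq0 ?gt_eqF.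
field.
rewrite -!mulr2n !mulrn_eq0 !expf_eq0 !mulf_eq0 !gt_eqF//.
by rewrite exprMn -rot_sd2 exprn_gt0.
Qed.

Lemma normal_prob_indic s (A : set R) : measurable A ->
  normal_prob 0 s A = (\int[leb]_x (normal_pdf 0 s x * \1_A x)%:E)%E.
Proof.
move=> mA; rewrite /normal_prob integral_mkcond; apply: eq_integral => x _.
by rewrite patchE indicE; case: ifP => _; rewrite ?mulr1 ?mulr0.
Qed.

Lemma measurable_rotation_set (b : R) (A B : set R) : measurable A -> measurable B ->
  measurable [set z : R * R | A (z.1 - b * (a * z.1 + z.2)) /\ B (a * z.1 + z.2)].
Proof.
move=> mA mB.
have mfst : measurable_fun setT (fun z : R * R => z.1) by exact: measurable_fst.
have msnd : measurable_fun setT (fun z : R * R => z.2) by exact: measurable_snd.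
have m2 : measurable_fun setT (fun z : R * R => a * z.1 + z.2).
  by apply: measurable_funD => //; exact: measurable_funM.
have m3 : measurable_fun setT (fun z : R * R => z.1 - b * (a * z.1 + z.2)).
  by apply: measurable_funB => //; exact: measurable_funM.
exact: measurableI (measurable_preimage m3 mA) (measurable_preimage m2 mB).
Qed.

(** The linear change of variables is split into two shears, each a translation for a fixed value of
    the other variable, with an exchange of integrals in between; only translation invariance of
    Lebesgue measure is involved. *)
Lemma normal_rotation (A B : set R) : measurable A -> measurable B ->
  (\int[normal_prob 0 s1]_x normal_prob 0 s2
     [set y | A (x - rot_coef * (a * x + y))%R /\ B (a * x + y)%R] =
   normal_prob 0 rot_res_sd A * normal_prob 0 rot_sd B)%E.
Proof.
move=> mA mB.
have mp s : measurable_fun setT (normal_pdf (0 : R) s) by exact: measurable_normal_pdf.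
have m1 (C : set R) : measurable C -> measurable_fun setT (\1_C : R -> R) by exact: measurable_indic.
pose W := [set z : R * R | A (z.1 - rot_coef * (a * z.1 + z.2)) /\ B (a * z.1 + z.2)].
have mW : measurable W by exact: measurable_rotation_set.
pose F x := normal_prob 0 s2 (xsection W x).
have mF : measurable_fun setT F.
  exact: (@measurable_fun_xsection _ _ R (measurableTypeR R) R (normal_prob 0 s2) W mW).
transitivity (\int[normal_prob 0 s1]_x F x)%E.
  by apply: eq_integral => x _; rewrite /F xsectionE.
rewrite ge0_integral_normal//.
(* The joint density times the two indicators, in the intermediate coordinates [x] and
   [u = a * x + y]. *)
pose k (z : R * R) := normal_pdf 0 s1 z.1 * normal_pdf 0 s2 (z.2 - a * z.1) *
  (\1_A (z.1 - rot_coef * z.2) * \1_B z.2).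
have k0 z : 0 <= k z by rewrite /k !mulr_ge0 ?normal_pdf_ge0 ?indicE.
have mk : measurable_fun setT k.
  have mfst : measurable_fun setT (fun z : R * R => z.1) by exact: measurable_fst.
  have msnd : measurable_fun setT (fun z : R * R => z.2) by exact: measurable_snd.
  apply: measurable_funM; apply: measurable_funM.
  - exact: measurableT_comp (mp s1) mfst.
  - apply: (measurableT_comp (mp s2)); apply: measurable_funB => //.
    exact: measurable_funM.
  - apply: (measurableT_comp (m1 A mA)); apply: measurable_funB => //.
    exact: measurable_funM.
  - exact: measurableT_comp (m1 B mB) msnd.
transitivity (\int[leb]_x \int[leb]_u (k (x, u))%:E)%E.
  apply: eq_integral => x _.
  pose g u := (normal_pdf 0 s2 (u - a * x) * (\1_A (x - rot_coef * u) * \1_B u))%:E.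
  have mg : measurable_fun setT g.
    apply/measurable_EFinP; apply: measurable_funM; last apply: measurable_funM => //.
      by apply: (measurableT_comp (mp s2)); exact: measurable_funB.
    by apply: (measurableT_comp (m1 A mA)); apply: measurable_funB => //; exact: measurable_funM.
  have g0 u : (0 <= g u)%E by rewrite lee_fin !mulr_ge0 ?normal_pdf_ge0 ?indicE.
  have -> : F x = (\int[leb]_u g u)%E.
    rewrite /F normal_prob_indic; last exact: measurable_xsection.
    rewrite -(integral_shift (a * x) mg g0); apply: eq_integral => y _; congr (_%:E).
    rewrite addrK addrC; congr (_ * _); rewrite !indicE -natrM mulnb; congr (_%:R).
    congr nat_of_bool; rewrite mem_xsection /W; apply/idP/andP; rewrite !inE /= [y + _]addrC.
      by rewrite [- _ + x]addrC.
    by rewrite [- _ + x]addrC.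
  rewrite -ge0_integralZr//; last by rewrite lee_fin normal_pdf_ge0.
  by apply: eq_integral => u _; rewrite -EFinM /k /=; congr (_%:E); ring.
have -> : (\int[leb]_x \int[leb]_u (k (x, u))%:E = \int[leb]_u \int[leb]_x (k (x, u))%:E)%E.
  apply: (@fubini_tonelli _ _ _ _ R leb leb (fun z => (k z)%:E)) => [|z].
    exact/measurable_EFinP.
  by rewrite lee_fin.
transitivity (\int[leb]_u ((normal_pdf 0 rot_sd u * \1_B u)%:E * normal_prob 0 rot_res_sd A))%E.
  apply: eq_integral => u _.
  have mku : measurable_fun setT (fun x => (k (x, u))%:E).
    by apply/measurable_EFinP; apply: (measurableT_comp mk); exact: measurable_pair2.
  rewrite -(integral_shift (rot_coef * u) mku)//; last by move=> x; rewrite lee_fin.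
  rewrite (normal_prob_indic _ mA) -ge0_integralZl//; last 3 first.
  - by apply/measurable_EFinP; exact: measurable_funM (mp _) (m1 A mA).
  - by move=> x _; rewrite lee_fin mulr_ge0 ?normal_pdf_ge0 ?indicE.
  - by rewrite lee_fin mulr_ge0 ?normal_pdf_ge0 ?indicE.
  apply: eq_integral => v _; rewrite -EFinM; congr (_%:E).
  by rewrite /k /= normal_pdf_rotation addrK; ring.
have nA0 : (0 <= normal_prob 0 rot_res_sd A)%E by exact: measure_ge0.
rewrite (normal_prob_indic rot_sd mB); move: nA0.
generalize (normal_prob 0 rot_res_sd A) => c c0; rewrite ge0_integralZr//; last 2 first.
- by apply/measurable_EFinP; exact: measurable_funM (mp _) (m1 B mB).
- by move=> u _; rewrite lee_fin mulr_ge0 ?normal_pdf_ge0 ?indicE.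
by rewrite muleC.
Qed.
End Rotation.

(** * Conditional probabilities *)

(** Comparison with the normal density of standard deviation [2 * s]: the wider exponential exceeds
    the narrower by the factor [expR t], [t = 3 x^2 / (8 s^2)], which dominates the absolute value
    up to a constant. *)
Lemma normal_abs_lty (R : realType) (s : R) : 0 < s ->
  (\int[normal_prob 0 s]_x (`|x|%:E) < +oo)%E.
Proof.
move=> s0; rewrite ge0_integral_normal//; last by apply/measurable_EFinP; exact: normr_measurable.
have s20 : 0 < 2 * s by rewrite mulr_gt0.
(* [8 * s ^+ 2 / 3] times [t] is [x ^+ 2], so the first factor times [1 + t] is at least
   [1 + x ^+ 2]; the second factor exchanges the normalizing peaks. *)
pose K := (1 + 8 * s ^+ 2 / 3) * (normal_peak s / normal_peak (2 * s)).
have p0 : 0 < normal_peak s by rewrite normal_peak_gt0 ?gt_eqF.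
have p20 : 0 < normal_peak (2 * s) by rewrite normal_peak_gt0 ?gt_eqF.
have K0 : 0 <= K.
  apply: mulr_ge0; last by apply: divr_ge0; exact: ltW.
  by apply: addr_ge0 => //; apply: divr_ge0 => //; exact: mulr_ge0 (ler0n _ _) (sqr_ge0 _).
apply: (@le_lt_trans _ _ (\int[lebesgue_measure]_x (K%:E * (normal_pdf 0 (2 * s) x)%:E))%E).
  apply: ge0_le_integral => //.
  - by move=> x _; rewrite lee_fin mulr_ge0 ?normal_pdf_ge0.
  - apply/measurable_EFinP; apply: measurable_funM; first exact: normr_measurable.
    exact: measurable_normal_pdf.
  - apply/measurable_EFinP; apply: measurable_funM => //.
    exact: measurable_normal_pdf.
  move=> x _; rewrite -EFinM lee_fin !normal_pdfE ?gt_eqF//.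
  rewrite [leLHS](_ : _ = normal_peak s * (`|x| * normal_fun 0 s x)); last by ring.
  rewrite [leRHS](_ : _ = normal_peak s * ((1 + 8 * s ^+ 2 / 3) * normal_fun 0 (2 * s) x)); last first.
    by rewrite /K; field; exact: lt0r_neq0.
  rewrite ler_pM2l//.
  rewrite /normal_fun !subr0; pose t := 3 * x ^+ 2 / (8 * s ^+ 2).
  have -> : expR (- x ^+ 2 / ((2 * s) ^+ 2 *+ 2)) = expR t * expR (- x ^+ 2 / (s ^+ 2 *+ 2)).
    rewrite -expRD /t !mulr2n; congr expR; field.
    by rewrite -!mulr2n !mulrn_eq0 !expf_eq0 !mulf_eq0 ?pnatr_eq0 (gt_eqF s0).
  rewrite mulrA ler_pM2r ?expR_gt0//.
  have s2 : 0 < s ^+ 2 by rewrite exprn_gt0.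
  have t0 : 0 <= t by apply: divr_ge0; exact: mulr_ge0 (ler0n _ _) (sqr_ge0 _).
  apply: (@le_trans _ _ ((1 + 8 * s ^+ 2 / 3) * (1 + t))); last first.
    by rewrite ler_wpM2l ?expR_ge1Dx// addr_ge0// divr_ge0// mulr_ge0// ltW.
  have -> : (1 + 8 * s ^+ 2 / 3) * (1 + t) = 1 + x ^+ 2 + (8 * s ^+ 2 / 3 + t).
    by rewrite /t; field; exact: lt0r_neq0.
  have h : 0 <= 8 * s ^+ 2 / 3 + t by rewrite addr_ge0// divr_ge0// mulr_ge0// ltW.
  have : `|x| <= 1 + x ^+ 2.
    by rewrite -[x ^+ 2]real_normK ?num_real//; have := sqr_ge0 (`|x| - 1); have := normr_ge0 x; nra.
  by move=> hx; apply: (le_trans hx); rewrite lerDl.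
rewrite ge0_integralZl//; last 2 first.
- by apply/measurable_EFinP; exact: measurable_normal_pdf.
- by move=> x _; rewrite lee_fin normal_pdf_ge0.
by rewrite integral_normal_pdf mule1 ltry.
Qed.

Section CondProb.
Context (R : realType) (d : measure_display) (Omega : measurableType d)
        (P : probability Omega R) (p : nat) (X : 'I_p -> Omega -> R).
Hypothesis mX : forall i, measurable_fun setT (X i).

Lemma sigmaX_set1 j E : sigmaX X [set j] E -> exists2 A, measurable A & E = X j @^-1` A.
Proof.
move: E; apply: (smallest_sub (C := sigma_algebra setT) (X := [set E | exists2 A, measurable A & E = X j @^-1` A])).
  split; first by exists set0 => //; rewrite preimage_set0.
  - by move=> _ [A mA ->]; exists (~` A); [exact: measurableC|rewrite setTD preimage_setC].
  - move=> F HF; have {HF}/choice[A HA] : forall n, exists A, measurable A /\ F n = X j @^-1` A.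
      by move=> n; have [A] := HF n; exists A.
    exists (\bigcup_n A n); first by apply: bigcupT_measurable => n; case: (HA n).
    by rewrite preimage_bigcup; apply: eq_bigcupr => n _; case: (HA n).
by move=> _ [s [B [/set1P -> mB ->]]]; exists B.
Qed.

Lemma condprob_measurable_lt C (h1 h2 : Omega -> R) :
  (forall U : set R, measurable U -> sigmaX X C (h1 @^-1` U)) ->
  (forall U : set R, measurable U -> sigmaX X C (h2 @^-1` U)) ->
  sigmaX X C [set w | h1 w < h2 w].
Proof.
move=> /measurable_sigma_type m1 /measurable_sigma_type m2.
have mlt := measurable_fun_ltr m1 m2.
by have := mlt (@measurableT _ (sigma_type X C)) [set true] (@measurableT _ bool); rewrite setTI.
Qed.

(** The set where [h1 < h2] is itself an event of [sigmaX X C], and over it both versions have the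
    same integral; a positive integrand of integral zero lives on a null set. *)
Lemma condprob_ae_le C E (h1 h2 : Omega -> R) :
  is_condprob P (sigmaX X C) E h1 -> is_condprob P (sigmaX X C) E h2 ->
  {ae P, forall w, h2 w <= h1 w}.
Proof.
move=> [m1 i1 e1] [m2 i2 e2]; have sG := condprob_measurable_lt m1 m2.
set G := [set w | h1 w < h2 w] in sG.
have mG : measurable G by apply: sigmaX_measurable sG.
have i1G : P.-integrable G (EFin \o h1) by apply: integrableS i1.
have i2G : P.-integrable G (EFin \o h2) by apply: integrableS i2.
have mB : measurable_fun G (fun w => (h2 w - h1 w)%:E).
  by have := measurable_int _ (integrableB mG i2G i1G).
have I0 : (\int[P]_(w in G) `|(h2 w - h1 w)%:E| = 0)%E.
  rewrite (eq_integral (fun w => (h2 w)%:E - (h1 w)%:E)%E); last first.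
    by move=> w /set_mem Gw; rewrite -EFinB gee0_abs// lee_fin subr_ge0 ltW.
  rewrite integralB_EFin// -e1// e2// subee//; exact: integrable_fin_num.
have [/(_ I0) + _] := ae_eq_integral_abs P mG mB; apply: filterS => w /= H.
by rewrite leNgt; apply/negP => /[dup] lt12 /H[] /eqP; rewrite subr_eq0 => /eqP E'; rewrite E' ltxx in lt12.
Qed.

Lemma condprob_ae_eq C E (h1 h2 : Omega -> R) :
  is_condprob P (sigmaX X C) E h1 -> is_condprob P (sigmaX X C) E h2 ->
  {ae P, forall w, h1 w = h2 w}.
Proof.
move=> c1 c2; have l1 := condprob_ae_le c1 c2; have l2 := condprob_ae_le c2 c1.
by move: l1 l2; apply: filterS2 => w h21 h12; apply/eqP; rewrite eq_le h12 h21.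
Qed.

(** The factor to be pulled out is itself an integral over [e] of indicators of events in
    [sigmaX X C]. Exchanging the integrals reduces the claim, for each fixed [e], to the defining
    identity of [hb]. *)
Lemma condprob_pullout C E hb G (M : Omega -> R) (nu : probability (measurableTypeR R) R) (A : set R) :
  measurable E -> is_condprob P (sigmaX X C) E hb -> sigmaX X C G ->
  measurable_fun setT (M : sigma_type X C -> R) -> measurable A ->
  (\int[P]_(w in E `&` G) nu [set e : R | A (M w + e)%R] =
   \int[P]_(w in G) ((hb w)%:E * nu [set e : R | A (M w + e)%R]))%E.
Proof.
move=> mE [mb ib eb] sG mM mA.
have sMB (B : set R) : measurable B -> sigmaX X C (M @^-1` B).
  by move=> mB; exact: (measurable_sigma_type _ _ _).1 mM B mB.
have mG : measurable G by apply: sigmaX_measurable sG.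
have mM' : measurable_fun setT M.
  by move=> _ B mB; rewrite setTI; apply: sigmaX_measurable (sMB _ mB).
pose AM := [set z : Omega * R | A (M z.1 + z.2)].
have mAM : measurable AM.
  apply: (measurable_preimage (f := fun z : Omega * R => M z.1 + z.2)) => //.
  by apply: measurable_funD => //; apply: measurableT_comp.
pose psi w := nu [set e : R | A (M w + e)].
have psiE w : psi w = (fine (psi w))%:E.
  by rewrite fineK// fin_num_measure//; apply: (measurable_preimage (f := fun e : R => M w + e)) => //; exact: measurable_funD.
have psi01 w : 0 <= fine (psi w) <= 1.
  rewrite fine_ge0//=; rewrite -lee_fin -psiE; apply: probability_le1.
  by apply: (measurable_preimage (f := fun e : R => M w + e)) => //; exact: measurable_funD.
have mpsi : measurable_fun setT (fun w => fine (psi w)).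
  have := measurableT_comp (measurable_shifted_prob nu mA) mM'.
  by move/(measurableT_comp (@fine_measurable R setT measurableT)).
pose g w := \1_G w * hb w - \1_(E `&` G) w.
have e1 : (fun w => (\1_G w * hb w)%:E) = (EFin \o hb) \_ G.
  by apply/funext => w; rewrite patchE indicE; case: ifP => _; rewrite ?mul1r ?mul0r.
have i1 : P.-integrable setT (fun w => (\1_G w * hb w)%:E).
  by rewrite e1; apply/(integrable_mkcond _ mG); apply: integrableS ib.
have mEG : measurable (E `&` G) by exact: measurableI.
have i2 : P.-integrable setT (fun w => (\1_(E `&` G) w)%:E) by exact: integrable_indic.
have ig : P.-integrable setT (EFin \o g) by exact: integrableB i1 i2.
have mg : measurable_fun setT g by apply/measurable_EFinP; exact: measurable_int ig.
pose f (z : Omega * R) := (g z.1 * \1_AM z)%:E.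
have mf : measurable_fun setT f.
  apply/measurable_EFinP; apply: measurable_funM; last exact: measurable_indic.
  by apply: measurableT_comp.
have Mshift w : measurable [set e : R | A (M w + e)].
  by apply: (measurable_preimage (f := fun e : R => M w + e)) => //; exact: measurable_funD.
have f_e w e : f (w, e) = ((g w)%:E * (\1_[set e : R | A (M w + e)] e)%:E)%E by [].
have intf : (P \x nu)%E.-integrable setT f.
  have [_ Hlt] := @integrable12ltyP _ _ _ _ R P nu f mf; apply: Hlt; apply: (@le_lt_trans _ _ (\int[P]_w `|(g w)%:E|)%E); last first.
    by have /integrableP[] := ig.
  apply: ge0_le_integral => //.
  - by move=> w _; exact: integral_ge0.
  - apply: (measurable_fun_fubini_tonelli_F (m2 := nu) (fun z => `|f z|%E)) => //.
    exact: measurableT_comp.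
  - by apply: measurableT_comp => //; exact/measurable_EFinP.
  move=> w _; apply: (@le_trans _ _ (\int[nu]_e `|(g w)%:E|)%E); last first.
    rewrite integral_cst//. by rewrite [X in (_ * X)%E](probability_setT nu) mule1.
  apply: ge0_le_integral => //.
  - by apply: measurableT_comp => //; apply: (measurableT_comp mf); exact: measurable_pair1.
  - move=> e _; rewrite lee_fin /= normrM indicE ler_piMr//.
    by case: (_ \in _); rewrite ?normr1 ?normr0.
have := Fubini intf.
have -> : (\int[P]_w \int[nu]_e f (w, e) = \int[P]_w ((g w)%:E * psi w))%E.
  apply: eq_integral => w _; under eq_integral do rewrite f_e.
  rewrite integralZl//; last by apply: integrable_indic => //; exact: Mshift.
  by rewrite integral_indic ?setIT//; exact: Mshift.
have -> : (\int[nu]_e \int[P]_w f (w, e) = 0)%E.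
  rewrite (eq_integral (cst 0%E)) ?integral0// => e _.
  pose Ae := [set w | A (M w + e)].
  (* For fixed [e] the event [Ae] is known given [C], so [hb] and the indicator of [E] have the same
     integral over [G] intersected with [Ae]. *)
  have sAe : sigmaX X C Ae.
    have mB : measurable [set m : R | A (m + e)].
      by apply: (measurable_preimage (f := fun m : R => m + e)) => //; exact: measurable_funD.
    exact: sMB mB.
  have mAe : measurable Ae by apply: sigmaX_measurable sAe.
  have sGA : sigmaX X C (G `&` Ae) by exact: (@measurableI _ (sigma_type X C)).
  have eGA := eb _ sGA.
  have ibGA : P.-integrable (G `&` Ae) (EFin \o hb) by apply: integrableS ib => //; exact: measurableI.
  transitivity (\int[P]_w (((EFin \o hb) \_ (G `&` Ae)) w - (\1_(E `&` G `&` Ae) w)%:E))%E.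
    apply: eq_integral => w _; rewrite /f /g patchE -[\1_AM (w, e)]/(\1_Ae w) !indicE !in_setI.
    by do ![case: (w \in _)]; rewrite /= -?EFinB; congr (_%:E); ring.
  rewrite integralB//; [|exact/(integrable_mkcond _ (measurableI _ _ mG mAe))|].
    rewrite -integral_mkcond integral_indic ?setIT//; last exact: measurableI.
    by rewrite -setIA -eGA subee// fin_num_measure//; apply: measurableI => //; exact: measurableI.
  by apply: integrable_indic => //; exact: measurableI.
have bpsi : [bounded fine (psi w) | w in [set: Omega]].
  exists 1; split; first exact: num_real.
  move=> y y1 w _ /=; have /andP[p0 p1] := psi01 w.
  by rewrite ger0_norm// (le_trans p1)// ltW.
have I1 := integrableMl measurableT i1 mpsi bpsi.
have I2 := integrableMl measurableT i2 mpsi bpsi.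
have -> : (\int[P]_w ((g w)%:E * psi w) = \int[P]_w ((\1_G w * hb w)%:E * (fine (psi w))%:E) -
     \int[P]_w ((\1_(E `&` G) w)%:E * (fine (psi w))%:E))%E.
  rewrite -integralB//; apply: eq_integral => w _.
  by rewrite psiE -!EFinM -EFinB /g; congr (_%:E); ring.
have fI1 := integrable_fin_num measurableT I1; have fI2 := integrable_fin_num measurableT I2.
move=> /eqP; rewrite sube_eq ?add0e//.
move=> /eqP E12; rewrite [RHS]integral_mkcond [LHS]integral_mkcond; apply/esym.
rewrite [LHS](_ : _ = \int[P]_w ((\1_G w * hb w)%:E * (fine (psi w))%:E))%E; last first.
  apply: eq_integral => w _; rewrite patchE indicE; case: ifP => _.
    by rewrite mul1r -psiE.
  by rewrite mul0r mul0e.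
rewrite [RHS](_ : _ = \int[P]_w ((\1_(E `&` G) w)%:E * (fine (psi w))%:E))%E; last first.
  apply: eq_integral => w _; rewrite patchE indicE; case: ifP => _.
    by rewrite mul1e -psiE.
  by rewrite mul0e.
exact: E12.
Qed.
End CondProb.

(** * Conditional independence caused by a vanishing edge function *)

Section CondIndep.
Context (R : realType) (d : measure_display) (Omega : measurableType d)
        (P : probability Omega R) (p : nat) (X : 'I_p -> Omega -> R).
Hypothesis mX : forall i, measurable_fun setT (X i).

(* Hence faithfulness forces every edge function to be nonzero. *)
Lemma sem_cond_indep D mu f sigma k j : is_dag D -> gaussian_sem P X D mu f sigma ->
  (k, j) \in D -> (forall y, f j k y = 0) ->
  cond_indep P X [set j] [set k] (parents D j :\ k).
Proof.
move=> dD sem kj f0.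
(* The proper ancestors of [j]: a parent-closed set that contains [k] and the conditioning set but
   not [j], so the noise of [j] is independent of it. *)
pose U := [set x | connect (edge_rel D) x j & x != j].
have cU : parent_closed D U.
  move=> u v; rewrite !inE => /andP[vj nvj] uv.
  have uj := connect_trans (edge_connect uv) vj; rewrite uj /=.
  by apply: contraTneq vj => E; apply: dD; rewrite -E.
have jU : j \notin U by rewrite inE eqxx andbF.
have pU u : (u, j) \in D -> u \in U.
  by move=> uj; rewrite inE edge_connect// (dag_neq dD uj).
set C := parents D j :\ k.
have CU : C \subset U.
  by apply/fintype.subsetP => u; rewrite finset.in_setD1 mem_parents => /andP[_]; exact: pU.
have kU : [set k]%SET \subset U by rewrite finset.sub1set pU.
set M := regression X D mu f j.
(* As [f j k] vanishes, the regression of [j] uses only the parents in [C]. *)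
have mM : measurable_fun setT (M : sigma_type X C -> R).
  have [_ cf _ _] := sem.
  apply: (@measurable_funD _ (sigma_type X C)) => //.
  rewrite (_ : (fun w => _) = (fun w => \sum_(i < p) if i \in C then f j i (X i w) else 0)); last first.
    apply/funext => w; rewrite big_mkcond; apply: eq_bigr => i _.
    by rewrite finset.in_setD1; have [->|ik] := eqVneq i k; rewrite /= ?f0 ?if_same.
  apply: (@measurable_sum _ (sigma_type X C)) => i; case: (boolP (i \in C)) => // iC.
  have iD : (i, j) \in D by move: iC; rewrite finset.in_setD1 mem_parents => /andP[].
  apply: (measurableT_comp (f := f j i)); first by apply: continuous_measurable_fun; exact: cf.
  by apply/measurable_sigma_type => B mB; exact: sigmaX_preimage.
move=> EA EB sA sB ha hb hab Ha Hb Hab.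
have mEB : measurable EB by apply: sigmaX_measurable sB.
have [A mA EAE] := sigmaX_set1 sA.
pose nu := normal_prob 0 (sigma j) : probability (measurableTypeR R) R.
have mshift m : measurable [set e : R | A (m + e)].
  by apply: (measurable_preimage (f := fun e : R => m + e)) => //; exact: measurable_funD.
(* The conditional probability of [EA] given all of [U]. It depends on [w] only through [M], so it
   is also a version given [C]. *)
pose h0 w := fine (nu [set e : R | A (M w + e)]).
have h0E w : nu [set e : R | A (M w + e)] = (h0 w)%:E by rewrite /h0 fineK//; apply: fin_num_measure; exact: mshift.
have h001 w : 0 <= h0 w <= 1.
  by rewrite fine_ge0//= -lee_fin -h0E; apply: probability_le1; exact: mshift.
have H0 G : sigmaX X U G -> P (EA `&` G) = (\int[P]_(w in G) (h0 w)%:E)%E.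
  move=> sG; rewrite setIC EAE (sem_disintegration mX dD sem cU jU pU sG mA).
  by apply: eq_integral => w _; rewrite -h0E.
have mh0 : measurable_fun setT (h0 : sigma_type X C -> R).
  have := measurableT_comp (measurable_shifted_prob nu mA) mM.
  by move/(measurableT_comp (@fine_measurable R setT measurableT)).
have mh0' : measurable_fun setT h0.
  move=> _ B mB; rewrite setTI; apply: (@sigmaX_measurable _ _ _ _ X C) => //.
  exact: (measurable_sigma_type _ _ _).1 mh0 B mB.
have bh0 : [bounded h0 w | w in [set: Omega]].
  exists 1; split; first exact: num_real.
  by move=> y y1 w _ /=; have /andP[p0 p1] := h001 w; rewrite ger0_norm// (le_trans p1)// ltW.
have C0 : is_condprob P (sigmaX X C) EA h0.
  split; first exact/measurable_sigma_type.
  - apply: measurable_bounded_integrable => //.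
    by rewrite (le_lt_trans (probability_le1 P _))// ltry.
  - by move=> G sG; apply: H0; apply: sigmaX_mono sG.
(* For [G] known given [C], the event [EB] intersected with [G] still belongs to [U], so [h0]
   integrates over it to the joint probability; pulling out [h0] replaces [EB] by [hb]. *)
have C1 : is_condprob P (sigmaX X C) (EA `&` EB) (fun w => hb w * h0 w).
  have [mb ib eb] := Hb; split.
  - apply/measurable_sigma_type; apply: (@measurable_funM _ (sigma_type X C)) => //.
    exact/measurable_sigma_type.
  - rewrite (_ : (fun w => _) = (EFin \o hb) \* (EFin \o h0))%E; last by apply/funext => w; rewrite /= EFinM.
    have I0 := integrableMl measurableT ib mh0' bh0. exact: I0.
  - move=> G sG; rewrite -setIA H0; last first.
      by apply: (@measurableI _ (sigma_type X U)); [apply: sigmaX_mono sB|apply: sigmaX_mono sG].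
    transitivity (\int[P]_(w in EB `&` G) nu [set e : R | A (M w + e)%R])%E.
      by apply: eq_integral => w _; rewrite h0E.
    rewrite (condprob_pullout mX nu mEB Hb sG mM mA).
    by apply: eq_integral => w _; rewrite h0E EFinM.
have e1 := condprob_ae_eq mX Hab C1; have e2 := condprob_ae_eq mX Ha C0.
by move: e1 e2; apply: filterS2 => w -> ->; rewrite mulrC.
Qed.
End CondIndep.

(** * Reversal of a linear covered edge *)

Section Reverse.
Context (R : realType) (d : measure_display) (Omega : measurableType d)
        (P : probability Omega R) (p : nat).
Variables (i j : 'I_p) (a : R).
Hypothesis ij : i != j.

Definition rot_family (sigma : 'I_p -> R) (Y : 'I_p -> Omega -> R) (l : 'I_p) (w : Omega) : R :=
  if l == i then Y i w - rot_coef a (sigma i) (sigma j) * (a * Y i w + Y j w)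
  else if l == j then a * Y i w + Y j w else Y l w.

Definition rot_sds (sigma : 'I_p -> R) (l : 'I_p) : R :=
  if l == i then rot_res_sd a (sigma i) (sigma j)
  else if l == j then rot_sd a (sigma i) (sigma j) else sigma l.

(** All coordinates but [i] and [j] are frozen in an event [G]. On [G] the pair of remaining noises
    is independent normal, and disintegration leaves exactly the integral of [normal_rotation]. *)
Lemma rot_family_joint_law sigma Y B : (forall l, 0 < sigma l) ->
    (forall l, measurable_fun setT (Y l)) -> mutually_independent P Y ->
    (forall l (B : set R), measurable B -> P (Y l @^-1` B) = normal_prob 0 (sigma l) B) ->
    (forall l, measurable (B l)) ->
  P (\bigcap_(l in [set: 'I_p]) (rot_family sigma Y l @^-1` B l)) =
    (\prod_(l < p) normal_prob 0 (rot_sds sigma l) (B l))%E.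
Proof.
move=> s0 mY indep law mB.
have ji : j == i = false by rewrite eq_sym (negPf ij).
(* The slots [i] and [j] are left open for arbitrary sets [A] and [C]; the others keep their sets
   [B l]. *)
pose K (A C : set R) l := if l == i then A else if l == j then C else B l.
have mK A C l : measurable A -> measurable C -> measurable (K A C l).
  by rewrite /K => mA mC; do ![case: ifP => // _].
pose rest := (\prod_(l < p | (l != i) && (l != j)) normal_prob 0 (sigma l) (B l))%E.
pose pre A C := \bigcap_(l in [set: 'I_p]) (Y l @^-1` K A C l).
have preE A C : measurable A -> measurable C ->
    P (pre A C) = (normal_prob 0 (sigma i) A * (normal_prob 0 (sigma j) C * rest))%E.
  move=> mA mC; rewrite /pre indep; last by move=> l; exact: mK.
  rewrite (bigD1 i)//= (bigD1 j)//=; last by rewrite ji.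
  rewrite /K eqxx ji eqxx !law//; congr (_ * (_ * _))%E.
  by apply: eq_bigr => l /andP[/negPf -> /negPf ->]; exact: law.
have nT l : normal_prob 0 (sigma l) setT = 1%E by exact: probability_setT.
set G := pre setT setT.
have mG : measurable G.
  apply: fin_bigcap_measurable => // l _; apply: measurable_preimage => //.
  exact: mK.
have PG : P G = rest by rewrite preE// !nT !mul1e.
have GE A C : G `&` Y i @^-1` A `&` Y j @^-1` C = pre A C.
  apply/seteqP; split=> w.
    move=> [[hG hA] hC] l _; have := hG l I; rewrite /K /preimage /=.
    by case: eqP => [->//|_]; case: eqP => [->//|].
  move=> h; split; [split|].
  - move=> l _; have := h l I; rewrite /K /preimage /=.
    by case: eqP => //; case: eqP.
  - by have := h i I; rewrite /K eqxx.
  - by have := h j I; rewrite /K ji eqxx.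
have GE1 A : G `&` Y i @^-1` A = pre A setT by rewrite -GE preimage_setT setIT.
pose W := [set z : R * R | B i (z.1 - rot_coef a (sigma i) (sigma j) * (a * z.1 + z.2)) /\ B j (a * z.1 + z.2)].
have mW : measurable W by exact: measurable_rotation_set.
have H A C : measurable A -> measurable C ->
    P (G `&` Y i @^-1` A `&` Y j @^-1` C) = (P (G `&` Y i @^-1` A) * normal_prob 0 (sigma j) C)%E.
  by move=> mA mC; rewrite GE GE1 !preE// nT mul1e -muleA [(_ * rest)%E]muleC.
have := @independent_disintegration _ _ _ _ _ _ _ P (normal_prob 0 (sigma j)) _ mG _ _ (mY i) (mY j) H W mW.
have -> : G `&` [set w | W (Y i w, Y j w)] = \bigcap_(l in [set: 'I_p]) (rot_family sigma Y l @^-1` B l).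
  apply/seteqP; split=> w.
    move=> [hG [hi hj]] l _; have := hG l I; rewrite /K /rot_family /preimage /=.
    by case: eqP => [->//|_]; case: eqP => [->//|].
  move=> h; split.
    move=> l _; have := h l I; rewrite /K /rot_family /preimage /=.
    by case: eqP => //; case: eqP.
  have := h i I; have := h j I.
  by rewrite /rot_family /preimage /= !eqxx ji.
move=> ->.
have mx : measurable_fun setT ((normal_prob 0 (sigma j) : probability (measurableTypeR R) R) \o xsection W).
  exact: (@measurable_fun_xsection _ _ R (measurableTypeR R) R (normal_prob 0 (sigma j)) W mW).
rewrite (@integral_independent _ _ _ _ _ P (normal_prob 0 (sigma i)) G mG (Y i) _ (mY i) mx)//; last first.
  by move=> A mA; rewrite GE1 preE// PG nT mul1e muleC.
rewrite PG; under eq_integral do rewrite /= xsectionE.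
rewrite (normal_rotation _ (s0 i) (s0 j) (mB i) (mB j)).
rewrite [RHS](bigD1 i)//= (bigD1 j)//=; last by rewrite ji.
rewrite /rot_sds eqxx ji eqxx muleC -muleA; congr (_ * (_ * _))%E.
by apply: eq_bigr => l /andP[/negPf -> /negPf ->].
Qed.

Lemma rot_family_law sigma Y l B : (forall l, 0 < sigma l) ->
    (forall l, measurable_fun setT (Y l)) -> mutually_independent P Y ->
    (forall l (B : set R), measurable B -> P (Y l @^-1` B) = normal_prob 0 (sigma l) B) ->
  measurable B -> P (rot_family sigma Y l @^-1` B) = normal_prob 0 (rot_sds sigma l) B.
Proof.
move=> s0 mY indep law mB.
pose BB k := if k == l then B else setT.
have := @rot_family_joint_law sigma Y BB s0 mY indep law.
rewrite (bigD1 l)//= big1; last first.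
  by move=> k kl; rewrite /BB (negPf kl); exact: probability_setT.
rewrite mule1 /BB eqxx => <-; last by move=> k; case: ifP.
congr (P _); apply/seteqP; split=> w; last by move=> /(_ l I); rewrite eqxx.
by move=> h k _; rewrite /preimage /=; case: eqP => // ->.
Qed.

Lemma rot_family_independent sigma Y : (forall l, 0 < sigma l) ->
    (forall l, measurable_fun setT (Y l)) -> mutually_independent P Y ->
    (forall l (B : set R), measurable B -> P (Y l @^-1` B) = normal_prob 0 (sigma l) B) ->
  mutually_independent P (rot_family sigma Y).
Proof.
move=> s0 mY indep law B mB; rewrite rot_family_joint_law//.
by apply: eq_bigr => l _; rewrite rot_family_law.
Qed.
End Reverse.

(** * Structural equations of the reversed graph *)

Section ReverseSem.
Context (R : realType) (d : measure_display) (Omega : measurableType d)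
        (P : probability Omega R) (p : nat) (X : 'I_p -> Omega -> R).
Hypothesis mX : forall i, measurable_fun setT (X i).
Variables (D : dag p) (mu : 'I_p -> R) (f : 'I_p -> 'I_p -> R -> R) (sigma : 'I_p -> R).
Variables (i j : 'I_p) (a b m : R).
Hypotheses (dD : is_dag D) (cv : covered D i j) (sem : gaussian_sem P X D mu f sigma)
  (aff : forall y, f j i y = a * y + b).

Let coef := rot_coef a (sigma i) (sigma j).
Let mean_j := mu j + b + a * mu i.

(* The constant [m], later the mean of [X j], centers the function of the new edge [j -> i]. *)
Definition reversed_fun (v k : 'I_p) (y : R) : R :=
  if v == j then a * f i k y + f j k y
  else if v == i then
    if k == j then coef * (y - m) else f i k y - coef * (a * f i k y + f j k y)
  else f v k y.

(** [mean_j] arises by substituting the equation of [X i] into that of [X j]. At [i], the term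
    [coef * m] compensates for the centering constant in the function of the new edge. *)
Definition reversed_mean (v : 'I_p) : R :=
  if v == j then mean_j else if v == i then mu i - coef * mean_j + coef * m else mu v.

Lemma reversed_residual v w :
  residual X (reverse_edge D i j) reversed_mean reversed_fun v w =
  rot_family i j a sigma (residual X D mu f) v w.
Proof.
have [ij cov] := coveredP cv; have ne := dag_neq dD ij.
have ji : j == i = false by rewrite eq_sym (negPf ne).
have pa_i u : u \in parents D i -> u != i by rewrite mem_parents => /(dag_neq dD).
have Sj (h : 'I_p -> R) : \sum_(k in parents D j) h k = h i + \sum_(k in parents D i) h k.
  rewrite (bigD1 i) ?mem_parents//=; congr (_ + _); apply: eq_bigl => k.
  by rewrite !mem_parents; case: (eqVneq k i) => [->|ki]; rewrite ?(negPf (dag_noloop _ dD)) ?andbF// andbT cov.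
have jn : (j, i) \notin D by exact: dag_asym.
rewrite /residual /rot_family /reversed_mean /reversed_fun -/coef.
have [->|vj] := eqVneq v j.
  rewrite ji (eq_bigl (fun k => k \in parents D i)); last first.
    move=> k; rewrite !mem_parents mem_reverse_edge eqxx ji /= andbF /=.
    by case: (eqVneq k i) => [->|ki]; rewrite ?(negPf (dag_noloop _ dD)) ?andbF//= ?andbT -?cov.
  rewrite Sj big_split/= -big_distrr/= aff /mean_j; ring.
have [->|vi] := eqVneq v i.
  rewrite (bigD1 j) ?mem_parents ?mem_reverse_edge ?eqxx//=.
  rewrite (eq_bigl (fun k => k \in parents D i)); last first.
    move=> k; rewrite !mem_parents mem_reverse_edge eqxx (negPf ne).
    case: (eqVneq k j) => [->|kj]; first by rewrite (negPf jn) andbF.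
    by rewrite /= andbF !andbT.
  rewrite (eq_bigr (fun k => f i k (X k w) - coef * (a * f i k (X k w) + f j k (X k w)))); last first.
    by move=> k; rewrite mem_parents => ki; rewrite ifN//; apply: contraNneq jn => <-.
  rewrite sumrB -big_distrr/= big_split/= -big_distrr/= Sj aff /mean_j; ring.
congr (_ - _ - _); apply: eq_bigl => k; rewrite !mem_parents mem_reverse_edge.
by rewrite (negPf vi) (negPf vj) !andbF /= andbT.
Qed.

(** Every new function is the new linear one, an old one, or a combination of old ones with the same
    source. Thus continuity, twice differentiability and centering all pass to the reversed model;
    [Q] sees the source [k] because centering refers to [X k]. *)
Lemma reversed_fun_ind (Q : 'I_p -> (R -> R) -> Prop) :
  (forall k v, (k, v) \in D -> Q k (f v k)) ->
  (forall k c g h, Q k g -> Q k h -> Q k (fun y => c * g y + h y)) ->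
  Q j (fun y => coef * (y - m)) ->
  forall k v, (k, v) \in reverse_edge D i j -> Q k (reversed_fun v k).
Proof.
move=> Qf Qc Qj k v; rewrite mem_reverse_edge.
have [ij cov] := coveredP cv; have ne := dag_neq dD ij.
have Qcomb k' : (k', i) \in D -> Q k' (fun y => a * f i k' y + f j k' y).
  by move=> ki; apply: Qc; apply: Qf => //; rewrite -cov// (dag_neq dD ki).
have [vj|vj] := eqVneq v j.
  rewrite vj [j == i]eq_sym (negPf ne) andbF andbT /= => /andP[kj ki].
  have -> : reversed_fun j k = (fun y => a * f i k y + f j k y).
    by apply/funext => y; rewrite /reversed_fun eqxx.
  by apply: Qcomb; rewrite cov.
have [vi|vi] := eqVneq v i; last first.
  rewrite andbF andbF /= andbT => kv.
  have -> : reversed_fun v k = f v k; last exact: Qf.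
  by apply/funext => y; rewrite /reversed_fun (negPf vi) (negPf vj).
rewrite vi andbT andbF /= andbT; have [->|kj] /= := eqVneq k j => [_|ki].
  have -> // : reversed_fun i j = (fun y => coef * (y - m)).
  by apply/funext => y; rewrite /reversed_fun (negPf ne) !eqxx.
have -> : reversed_fun i k = (fun y => - coef * (a * f i k y + f j k y) + f i k y).
  by apply/funext => y; rewrite /reversed_fun (negPf ne) eqxx (negPf kj) mulNr addrC.
by apply: Qc; [exact: Qcomb|exact: Qf].
Qed.

Lemma reversed_sem : gaussian_sem P X (reverse_edge D i j) reversed_mean reversed_fun (rot_sds i j a sigma).
Proof.
have [s0 cf indep law] := sem.
have [ij cov] := coveredP cv; have ne := dag_neq dD ij.
have mres := measurable_residual mX sem.
have resE : residual X (reverse_edge D i j) reversed_mean reversed_fun =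
    rot_family i j a sigma (residual X D mu f).
  by apply/funext => v; apply/funext => w; exact: reversed_residual.
split.
- move=> l; rewrite /rot_sds; case: ifP => _; first exact: rot_res_sd_gt0.
  by case: ifP => _; [exact: rot_sd_gt0|].
- have comb (c : R) (g h : R -> R) : continuous g -> continuous h -> continuous (fun y => c * g y + h y).
    move=> cg ch y; apply: (@continuousD _ _ _ (fun y => c * g y) h); last exact: ch.
    by apply: continuousM; [exact: cst_continuous|exact: cg].
  have cid : continuous (fun y : R => y) by move=> z; exact: cvg_id.
  have ccst : continuous (fun y : R => - (coef * m)) by move=> z; exact: cst_continuous.
  apply: (reversed_fun_ind (Q := fun _ g => continuous g)).
  + by move=> k v; exact: cf.
  + by move=> k; exact: comb.
  + rewrite (_ : (fun y => _) = (fun y => coef * y + - (coef * m))); first exact: comb.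
    by apply/funext => y; rewrite mulrBr.
- by rewrite resE; exact: rot_family_independent.
- by move=> l B mB; rewrite resE; exact: rot_family_law.
Qed.
End ReverseSem.

(** * Twice differentiable functions *)

Section Calculus.
Context (R : realType).
Implicit Types (f g : R -> R) (a b c x : R).

Lemma is_derive_comb c f g x df dg : is_derive x 1 f df -> is_derive x 1 g dg ->
  is_derive x 1 (fun y => c * f y + g y) (c * df + dg).
Proof.
move=> f1 g1.
have h2 : is_derive x 1 (fun y => c * f y) (c * df) by apply: (@is_deriveZ R R^o R^o f c x 1 df).
exact: (@is_deriveD R R^o R^o _ _ x 1 _ _ h2 g1).
Qed.

Lemma is_derive1 f x : derivable f x 1 -> is_derive x 1 f (derive1 f x).
Proof. by move=> df; apply: DeriveDef => //; rewrite derive1E. Qed.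

Lemma derive1_is_derive f df : (forall x, is_derive x 1 f (df x)) -> derive1 f = df.
Proof. by move=> H; apply/funext => x; rewrite derive1E; case: (H x). Qed.

Lemma C2_comb c f g : C2 f -> C2 g -> C2 (fun y => c * f y + g y).
Proof.
move=> [f1 f2 f3] [g1 g2 g3].
have H1 x := is_derive_comb c (is_derive1 (f1 x)) (is_derive1 (g1 x)).
have H2 x := is_derive_comb c (is_derive1 (f2 x)) (is_derive1 (g2 x)).
have e1 := derive1_is_derive H1; have e2 := derive1_is_derive H2.
split=> [x|x|]; first by case: (H1 x).
  by rewrite e1; case: (H2 x).
rewrite /derive1n /= e1 e2 => x; apply: (@continuousD _ _ _ (fun y => c * derive1n 2 f y) (derive1n 2 g)).
  by apply: continuousM; [exact: cst_continuous|exact: f3].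
exact: g3.
Qed.

Lemma C2_continuous f : C2 f -> continuous f.
Proof. by case=> f1 _ _ x; apply/differentiable_continuous/derivable1_diffP. Qed.

Lemma is_derive_affine a b x : is_derive x 1 (fun y => a * y + b) a.
Proof.
have := is_derive_comb a (is_derive_id x (1 : R)) (is_derive_cst b x (1 : R)).
by rewrite mulr1 addr0.
Qed.

Lemma derive1n2_affine a b : derive1n 2 (fun y => a * y + b) = cst 0.
Proof.
rewrite /derive1n /= (derive1_is_derive (is_derive_affine a b)).
exact: (derive1_is_derive (fun x => is_derive_cst a x (1 : R))).
Qed.

Lemma C2_affine a b : C2 (fun y => a * y + b).
Proof.
split=> [x|x|]; first by case: (is_derive_affine a b x).
  by rewrite (derive1_is_derive (is_derive_affine a b)); exact: derivable_cst.
by rewrite derive1n2_affine; exact: cst_continuous.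
Qed.

Lemma affine_derive1n2 f x : affine_fun f -> derive1n 2 f x = 0.
Proof.
move=> [a [b ab]]; have -> : f = (fun y => a * y + b) by apply/funext.
by rewrite derive1n2_affine.
Qed.

Lemma derive1n2_eq0_affine f : C2 f -> (forall x, derive1n 2 f x = 0) -> affine_fun f.
Proof.
move=> [f1 f2 _] H.
have c1 x y : derive1 f x = derive1 f y.
  apply: is_derive_0_is_cst => z; rewrite -(H z); exact: is_derive1.
pose a := derive1 f 0; exists a, (f 0) => y.
have c2 : - a * y + f y = - a * 0 + f 0.
  apply: (@is_derive_0_is_cst _ (fun y => - a * y + f y)) => z.
  have := is_derive_comb (- a) (is_derive_id z (1 : R)) (is_derive1 (f1 z)).
  by rewrite mulr1 (c1 z 0) addNr.
by rewrite -[f y](addKr (- a * y)) c2 mulNr opprK mulr0 add0r.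
Qed.
End Calculus.

(** * The class of DAGs generating the distribution *)

Section Plsem.
Context (R : realType) (d : measure_display) (Omega : measurableType d)
        (P : probability Omega R) (p : nat) (X : 'I_p -> Omega -> R).
Hypothesis mX : forall i, measurable_fun setT (X i).
Implicit Types (D : dag p) (i j k v : 'I_p).

Lemma PLSEM_gaussian_sem D mu f sigma : PLSEM_generates P X D mu f sigma ->
  gaussian_sem P X D mu f sigma.
Proof.
move=> [s0 Hf [indep law]]; split=> // i j ij.
by have [c2 _ _ _] := Hf _ _ ij; exact: C2_continuous.
Qed.

Definition centered (g : Omega -> R) :=
  P.-integrable setT (fun w => (g w)%:E) /\ (\int[P]_w (g w)%:E = 0)%E.

Lemma centered_comb c g h : centered g -> centered h -> centered (fun w => c * g w + h w).
Proof.
move=> [ig eg] [ih eh].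
have icg : P.-integrable setT (fun w => (c * g w)%:E).
  by have := integrableZl measurableT c ig; apply: eq_integrable => // w _; rewrite EFinM.
split; first by have := integrableD measurableT icg ih; apply: eq_integrable.
rewrite (integralD_EFin measurableT icg ih) eh adde0.
rewrite (eq_integral (fun w => c%:E * (g w)%:E)%E); last by move=> w _; rewrite /= EFinM.
by rewrite integralZl// eg mule0.
Qed.

Lemma integrable_residual D mu f sigma v : gaussian_sem P X D mu f sigma ->
  P.-integrable setT (fun w => (residual X D mu f v w)%:E).
Proof.
move=> sem; have mr := measurable_residual mX sem v; have [s0 _ _ law] := sem.
apply/integrableP; split; first exact/measurable_EFinP.
have mabs : measurable_fun setT (fun x : R => (`|x|)%:E).
  by apply/measurable_EFinP; exact: normr_measurable.
have := @integral_independent _ _ _ _ _ P (normal_prob 0 (sigma v)) setT measurableT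
  (residual X D mu f v) (fun x : R => (`|x|)%:E) mr mabs.
move=> ->//; last by move=> A mA; rewrite setTI probability_setT mul1e law.
by rewrite probability_setT mul1e; exact: normal_abs_lty.
Qed.

Lemma PLSEM_integrable D mu f sigma v : PLSEM_generates P X D mu f sigma ->
  P.-integrable setT (fun w => (X v w)%:E).
Proof.
move=> gen; have sem := PLSEM_gaussian_sem gen; have [_ Hf _] := gen.
have ir := integrable_residual v sem.
have is_ : P.-integrable setT (fun w => (\sum_(i in parents D v) f v i (X i w))%:E).
  have H : P.-integrable setT (fun w => \sum_(i in parents D v) (f v i (X i w))%:E)%E.
    apply: integrable_sum => // i; rewrite mem_parents => iv.
    by have [] := Hf _ _ iv.
  by move: H; apply: eq_integrable => // w _; rewrite sumEFin.
have ic : P.-integrable setT (fun w => (mu v)%:E) by exact: finite_measure_integrable_cst.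
have := integrableD measurableT (integrableD measurableT ic is_) ir.
by apply: eq_integrable => // w _; rewrite (regression_residual X D mu f v w) /regression !EFinD.
Qed.

Lemma centered_shift v : P.-integrable setT (fun w => (X v w)%:E) ->
  centered (fun w => X v w - fine (\int[P]_w (X v w)%:E)).
Proof.
move=> iX; set m := fine _.
have ic : P.-integrable setT (fun w => m%:E) by exact: finite_measure_integrable_cst.
split; first by have := integrableB measurableT iX ic; apply: eq_integrable => // w _; rewrite /= EFinB.
rewrite (eq_integral (fun w => (X v w)%:E - m%:E)%E); last by move=> w _; rewrite EFinB.
rewrite integralB_EFin// integral_cst// [X in (_ * X)%E](probability_setT P) mule1 /m fineK ?subee//.
  exact: integrable_fin_num.
exact: integrable_fin_num.
Qed.

Lemma inDP_same_d_separation D D' : faithful P X D -> faithful P X D' -> same_d_separation D D'.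
Proof. by move=> fD fD' A B C dAB dAC dBC; rewrite -(fD _ _ _ dAB dAC dBC) fD'. Qed.

Lemma reverse_faithful D i j : is_dag D -> covered D i j -> faithful P X D ->
  faithful P X (reverse_edge D i j).
Proof. by move=> dD cv fD A B C dAB dAC dBC; rewrite (fD _ _ _ dAB dAC dBC); exact: reverse_d_separated. Qed.

Lemma faithful_edge_nonzero D mu f sigma k j : is_dag D -> faithful P X D ->
  gaussian_sem P X D mu f sigma -> (k, j) \in D -> exists x, f j k x != 0.
Proof.
move=> dD fD sem kj; apply: contrapT => nex.
have f0 y : f j k y = 0 by apply/eqP/negPn/negP => h; apply: nex; exists y.
have ci := sem_cond_indep mX dD sem kj f0; have nkj := dag_neq dD kj.
have jk : j != k by rewrite eq_sym.
move: ci; rewrite fD; first 1 last.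
- exact: disjoint_single.
- by rewrite disjoints1 finset.in_setD1 mem_parents (negPf (dag_noloop _ dD)) andbF.
- by rewrite disjoints1 finset.in_setD1 eqxx.
by apply: adjacent_not_separated => //; rewrite /adjacent kj orbT.
Qed.

Lemma inDP_reverse D i j mu f sigma : inDP P X D -> covered D i j ->
  PLSEM_generates P X D mu f sigma -> affine_fun (f j i) -> inDP P X (reverse_edge D i j).
Proof.
move=> [dD fD _] cv gen [a [b aff]]; have sem := PLSEM_gaussian_sem gen.
have [_ Hf _] := gen.
pose m := fine (\int[P]_w (X j w)%:E).
have semR := reversed_sem mX m dD cv sem aff.
have dD' := reverse_is_dag dD cv; have fD' := reverse_faithful dD cv fD.
split=> //; exists (reversed_mean mu sigma i j a b m), (reversed_fun f sigma i j a m), (rot_sds i j a sigma).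
have [s0 _ indep law] := semR.
split=> // k v kv.
have cent := reversed_fun_ind (a := a) (sigma := sigma) (m := m) dD cv
  (f := f) (Q := fun k g => centered (fun w => g (X k w))).
have c2 := reversed_fun_ind (a := a) (sigma := sigma) (m := m) dD cv
  (f := f) (Q := fun k g => C2 g).
have [||| ic ec] := cent _ _ _ k v kv.
- by move=> k' v' kv'; have [] := Hf _ _ kv'.
- by move=> k' c g h; exact: centered_comb.
- have c0 : centered (fun=> 0).
    by split; [exact: finite_measure_integrable_cst|rewrite integral0].
  have := centered_comb (rot_coef a (sigma i) (sigma j)) (centered_shift (PLSEM_integrable j gen)) c0.
  by under [X in centered X]eq_fun do rewrite addr0.
split=> //; last exact: faithful_edge_nonzero dD' fD' semR kv.
apply: c2 kv => [k' v' kv'|k' c g h|].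
- by have [] := Hf _ _ kv'.
- exact: C2_comb.
- rewrite (_ : (fun y => _) = (fun y => rot_coef a (sigma i) (sigma j) * y + - (rot_coef a (sigma i) (sigma j) * m))).
    exact: C2_affine.
  by apply/funext => y; rewrite mulrBr.
Qed.

Lemma inDP_adjacent D D' i j : inDP P X D -> inDP P X D' -> (i, j) \in D -> (i, j) \notin D' -> (j, i) \in D'.
Proof.
move=> [dD fD _] [dD' fD' _] ij nij.
have := same_skeleton i j dD dD' (inDP_same_d_separation fD fD').
by rewrite /adjacent ij (negPf nij) /= => <-.
Qed.

(** The common source of the claims: [D'] may be the reversal of [D], an arbitrary member lacking
    the edge, or the target of the chain. *)
Lemma covered_not_in_linear D D' i j : inDP P X D -> inDP P X D' -> covered D i j -> (i, j) \notin D' ->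
  linear_in P X D i j.
Proof.
move=> DP DP' cv nij; split=> // mu f sigma gen x; apply: affine_derive1n2.
have ij : (i, j) \in D by case: cv.
have ji' := inDP_adjacent DP DP' ij nij.
have [dD _ _] := DP; have [dD' _ [mu' [f' [sigma' gen']]]] := DP'.
exact (sem_reversed_affine mX dD (PLSEM_gaussian_sem gen) dD' (PLSEM_gaussian_sem gen') cv ji').
Qed.

Lemma linear_reverse D i j : covered D i j -> linear_in P X D i j -> inDP P X (reverse_edge D i j).
Proof.
move=> cv [DP lin]; have [_ _ [mu [f [sigma gen]]]] := DP.
have ij : (i, j) \in D by case: cv.
apply: (inDP_reverse DP cv gen); apply: derive1n2_eq0_affine; last exact: lin gen.
by have [_ Hf _] := gen; have [] := Hf _ _ ij.
Qed.

Lemma upair_eq (e1 e2 : 'I_p * 'I_p) : upair e1 = upair e2 -> e1 = e2 \/ e1 = (e2.2, e2.1).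
Proof.
case: e1 e2 => [x y] [z t]; rewrite /upair /= => E.
have h1 : x \in [set z; t]%SET by rewrite -E !inE eqxx.
have h2 : y \in [set z; t]%SET by rewrite -E !inE eqxx orbT.
have h3 : z \in [set x; y]%SET by rewrite E !inE eqxx.
have h4 : t \in [set x; y]%SET by rewrite E !inE eqxx orbT.
move: h1 h2 h3 h4; rewrite !inE.
move=> /orP[/eqP->|/eqP->] /orP[/eqP->|/eqP->] /=; rewrite ?orbb => /eqP ? /eqP ?; subst; auto.
Qed.

(** Induction on the number of edges of [D] outside [D']. The extra clause keeps every reversed edge
    in that set, with its orientation in [D]: after [(i, j)] is removed from it, neither [(i, j)]
    nor, by acyclicity, [(j, i)] can be reversed later. *)
Lemma inDP_reversal_chain D D' : inDP P X D -> inDP P X D' ->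
  exists es, [/\ reversal_chain P X D es D', uniq [seq upair e | e <- es] &
    forall e, e \in es -> e \in D :\: D'].
Proof.
have [n] := ubnP #|D :\: D'|; elim: n D => // n IH D ltn DP DP'.
have [->|/eqP neq] := eqVneq D D'; first by exists [::].
have [dD fD _] := DP; have [dD' fD' _] := DP'.
have [i [j [cv ji']]] := covered_reversed_edge dD dD' (inDP_same_d_separation fD fD') neq.
have ij : (i, j) \in D by case: cv.
have nij : (i, j) \notin D' by exact: dag_asym.
have lin := covered_not_in_linear DP DP' cv nij.
have DP1 := linear_reverse cv lin.
(* The reversal gains only [(j, i)], which already belongs to [D'], so the difference loses [(i, j)]
   and gains nothing. *)
have Dsub : reverse_edge D i j :\: D' \subset (D :\: D') :\ (i, j).
  apply/fintype.subsetP => -[u v]; rewrite finset.in_setD mem_reverse_edge => /andP[nuv].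
  case/orP => [/andP[/eqP uj /eqP vi]|/andP[uv nuvij]]; first by rewrite uj vi ji' in nuv.
  by rewrite finset.in_setD1 finset.in_setD uv nuv xpair_eqE nuvij.
have [|es [ch us sub]] := IH (reverse_edge D i j) _ DP1 DP'.
  apply: leq_ltn_trans (subset_leq_card Dsub) _.
  have := cardsD1 (i, j) (D :\: D'); rewrite finset.in_setD ij nij /= add1n => E.
  by rewrite -ltnS -E.
exists ((i, j) :: es); split=> //=.
- rewrite us andbT; apply/mapP => -[e /sub /(fintype.subsetP Dsub)].
  rewrite finset.in_setD1 finset.in_setD => /and3P[ne _ eD] /upair_eq[E|E].
    by rewrite E eqxx in ne.
  have eE : e = (j, i) by case: e E {ne eD} => x y [-> ->].
  by rewrite eE (negPf (dag_asym dD ij)) in eD.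
- move=> e; rewrite inE => /orP[/eqP->|/sub /(fintype.subsetP Dsub)].
    by rewrite finset.in_setD ij nij.
  by rewrite finset.in_setD1 => /andP[].
Qed.
End Plsem.

Theorem mainTheorem2 (R : realType) (d : measure_display) (Omega : measurableType d)
  (P : probability Omega R) (p : nat) (X : 'I_p -> Omega -> R)
  (hX : forall i, measurable_fun setT (X i))
  (hP : exists D0 : dag p, inDP P X D0) :
  (forall (D : dag p) (i j : 'I_p), inDP P X D -> covered D i j ->
     (inDP P X (reverse_edge D i j) <-> linear_in P X D i j) /\
     (~ linear_in P X D i j -> forall D' : dag p, inDP P X D' -> (i, j) \in D')) /\
  (forall D D' : dag p, inDP P X D -> inDP P X D' ->
     exists es : seq ('I_p * 'I_p),
       reversal_chain P X D es D' /\ uniq [seq upair e | e <- es]).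
Proof.
split=> [D i j DP cv|D D' DP DP']; last first.
  have [es [ch us _]] := inDP_reversal_chain hX DP DP'; by exists es.
have [dD _ _] := DP.
split; last first.
  move=> nlin D' DP'; apply/negPn/negP => nij; apply: nlin.
  exact (covered_not_in_linear hX DP DP' cv nij).
split; last by move=> lin; exact (linear_reverse hX cv lin).
move=> DP'; apply: (covered_not_in_linear hX DP DP' cv).
by rewrite mem_reverse_edge !eqxx [i == j](negPf (dag_neq dD cv.1)) /= andbF.
Qed.
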